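(* Let $A\in\mathbb{R}^{n\times d}$ be an Auerbach basis of a $d$-dimensional subspace of $(\mathbb{R}^n,\|\cdot\|_1)$. Let $u_1,\dots,u_n$ be i.i.d. standard exponential random variables and $D\in\mathbb{R}^{n\times n}$ diagonal with $D_{ii}=1/u_i$. Let $S\in\mathbb{R}^{m\times n}$ with $m=\tilde O(d)$ be drawn (independently of $D$) from a sparse oblivious subspace embedding with $s=\log^{O(1)}d$ nonzeros per column, of the form $S=\frac{1}{\sqrt s}(S_1;\dots;S_s)$ where each $S_j\in\mathbb{R}^{(m/s)\times n}$ has in each column exactly one nonzero entry, equal to a uniformly random sign in a uniformly random row. Let $\Pi=SD$. Then with probability at least $2/3$, for all $x\in\mathbb{R}^d$, $$\Omega\Big(\max\Big\{\frac{1}{d\log d},\ \frac{1}{\sqrt{d\log d\log n}}\Big\}\Big)\cdot\|Ax\|_1\le\|\Pi Ax\|_1\le\tilde O(d)\cdot\|Ax\|_1.$$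
   Context: $\tilde O(f)$ denotes a quantity of the form $f\cdot\log^{O(1)}(f)$. A standard exponential random variable has density $e^{-x}$ on $[0,\infty)$. An oblivious subspace embedding (for $d$) is a distribution over $m\times n$ matrices $S$ such that for every fixed $d$-dimensional subspace $V\subseteq\mathbb{R}^n$, with probability $0.99$ over $S$, $\frac12\|v\|_2\le\|Sv\|_2\le\frac32\|v\|_2$ for all $v\in V$. An Auerbach basis of a $d$-dimensional subspace $V$ of $(\mathbb{R}^n,\|\cdot\|_1)$ is a matrix $A$ whose columns $A_1,\dots,A_d$ form a basis of $V$ with $\|A_i\|_1=1$ for all $i$ and $|x_i|\le\|Ax\|_1$ for all $x$. *)

(* Defs.v *)
From HB Require Import structures.
From mathcomp Require Export all_boot all_order all_algebra.
From mathcomp Require Export all_classical all_reals all_analysis.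

Set Implicit Arguments.
Unset Strict Implicit.
Unset Printing Implicit Defensive.

Import Order.TTheory GRing.Theory Num.Theory.
Import numFieldNormedType.Exports.

Local Open Scope classical_set_scope.
Local Open Scope ring_scope.

Definition l1norm (R : realType) (n : nat) (v : 'cV[R]_n) : R :=
  \sum_(i < n) `|v i 0|.

Definition l2norm (R : realType) (n : nat) (v : 'cV[R]_n) : R :=
  Num.sqrt (\sum_(i < n) v i 0 ^+ 2).

Definition auerbach_basis (R : realType) (n d : nat)
    (V : {vspace 'cV[R]_n}) (A : 'M[R]_(n, d)) : Prop :=
  [/\ basis_of V [tuple col i A | i < d],
      forall i : 'I_d, l1norm (col i A) = 1
    & forall (x : 'cV[R]_d) (i : 'I_d), `|x i 0| <= l1norm (A *m x)].

Section Probability.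
Context (disp : measure_display) (T : measurableType disp) (R : realType).
Variable P : probability T R.

Definition mutually_independent (n : nat) (u : 'I_n -> {RV P >-> R}) : Prop :=
  forall (J : {set 'I_n}) (B : 'I_n -> set R),
    (forall i, i \in J -> measurable (B i)) ->
    P (\bigcap_(i in [set` J]) (u i @^-1` B i)) =
      (\prod_(i in J) P (u i @^-1` B i))%E.

(* The law is compared on measurable sets only: [exponential_prob] is an
   integral, which carries no meaning over a non-measurable set. *)
Definition standard_exponential (X : {RV P >-> R}) : Prop :=
  forall B : set R, measurable B -> distribution P X B = exponential_prob 1 B.

Definition iid_standard_exponential (n : nat) (u : 'I_n -> {RV P >-> R}) :
    Prop :=
  mutually_independent u /\ forall i, standard_exponential (u i).

(* Independence of a random matrix with finitely many values from a finite
   family of random variables: the events [S = M] and the boxes generate the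
   two sigma-algebras. *)
Definition discrete_independent (m n k : nat) (S : T -> 'M[R]_(m, n))
    (u : 'I_k -> {RV P >-> R}) : Prop :=
  forall (M : 'M[R]_(m, n)) (B : 'I_k -> set R),
    (forall i, measurable (B i)) ->
    P ((S @^-1` [set M]) `&` \bigcap_i (u i @^-1` B i)) =
      (P (S @^-1` [set M]) * P (\bigcap_i (u i @^-1` B i)))%E.

Definition oblivious_subspace_embedding (d m n : nat)
    (S : T -> 'M[R]_(m, n)) : Prop :=
  forall V : {vspace 'cV[R]_n}, \dim V = d ->
    ((99 / 100 : R)%:E <=
      P [set w | forall v : 'cV[R]_n, v \in V ->
           ((1 / 2) * l2norm v <= l2norm (S w *m v) <= (3 / 2) * l2norm v)%R])%E.

Definition sign_row_matrix (r n : nat) (h : 'I_n -> 'I_r) (sg : 'I_n -> bool) :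
    'M[R]_(r, n) :=
  \matrix_(i < r, k < n) (if i == h k then (-1) ^+ (sg k) else 0).

(* S = s^(-1/2) (S_1; ...; S_s), where column k of S_j has its nonzero entry in
   row [h j k], with sign (-1)^[sg j k].  For each j and k the pair (row, sign)
   is uniform over its 2 (m / s) values; the joint law of the pairs attached to
   different (j, k) is left free, and fully independent pairs are one instance.
   The type of S has [\sum_(j < s) (m %/ s)] rows, which is m when s divides m. *)
Definition sparse_sign_form (m s n : nat)
    (S : T -> 'M[R]_(\sum_(j < s) (m %/ s), n)) : Prop :=
  exists (h : 'I_s -> 'I_n -> T -> 'I_(m %/ s)) (sg : 'I_s -> 'I_n -> T -> bool),
    (forall w, S w = (Num.sqrt (s%:R : R))^-1 *:
       \mxcol_(j < s) sign_row_matrix (fun k => h j k w) (fun k => sg j k w)) /\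
    (forall j k i b,
       measurable [set w | h j k w = i /\ sg j k w = b] /\
       P [set w | h j k w = i /\ sg j k w = b] =
         ((2 * (m %/ s)%:R : R)^-1)%:E).

Definition inverse_diag (n : nat) (u : 'I_n -> {RV P >-> R}) (w : T) :
    'M[R]_n :=
  diag_mx (\row_(i < n) (u i w)^-1).

End Probability.

(* Main.v *)
(** Condition on [D].  The embedding property of [S] only ever gets applied to
    finitely many vectors lying in a [d]-dimensional subspace determined by [D],
    so only a fixed subspace is involved; the other property of [S] that enters is
    its column sparsity, through [|S v|_1 <= sqrt s |v|_1].

    Dilation.  By the Auerbach property it suffices to bound
    [sum_i |S D A_i|_1].  Split the entries of [D A] at the level [tau = 1 / poly(d)].
    The small entries have squared l2 mass [O(d tau)] in expectation; on them [S]
    is a near isometry, and the l1 norm costs a factor [sqrt m] with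
    [m tau <= 1].  The large ones have l1 mass [O(d log d)] once entries above
    [poly(d)] are excluded, since [1 / u] has tail [P(1 / u > x) <= 1 / x], and
    [S] increases the l1 norm by at most [sqrt s].

    Contraction.  [|S D y|_1 >= |S D y|_2 >= |D y|_2 / 2], and a Laplace transform
    bound gives [|D y|_2^2 >= |y|_1^2 / (12 t L)] up to probability [exp (- t / 12)]
    provided all [u_k <= L] or [t <= L].  With [t] of order [d log d] and
    [L = min (t, O(log n))] this survives a union bound over a grid of mesh
    [1 / poly(d)] in the cube that contains the coordinates of the unit sphere,
    and the dilation bound passes from the grid to the whole sphere. *)
Require Import Defs.
From mathcomp Require Import measurable_realfun zify ring lra.

Set Implicit Arguments.
Unset Strict Implicit.
Unset Printing Implicit Defensive.

Import Order.TTheory GRing.Theory Num.Theory.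
Import numFieldNormedType.Exports.

Local Open Scope classical_set_scope.
Local Open Scope ring_scope.

(** * Measurability and exponential variables *)

Section Measurability.
Context (disp : measure_display) (T : measurableType disp) (R : realType).

(** Inversion is discontinuous at [0], so [1 / f] is rewritten as [f] times a real power of [f^2],
    which is measurable. Where [f] vanishes both sides are [0], since [0^-1 = 0]. *)
Lemma measurable_fun_inv (f : T -> R) : measurable_fun setT f ->
  measurable_fun setT (fun w => (f w)^-1).
Proof.
move=> mf.
have -> : (fun w => (f w)^-1) = (fun w => f w * (f w ^+ 2) `^ (-1)).
  apply/funext => w; rewrite powRN powRr1 ?sqr_ge0//.
  have [->|f0] := eqVneq (f w) 0; first by rewrite invr0 mul0r.
  by field.
apply: measurable_funM => //.
apply: (measurableT_comp (measurable_powR (-1))).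
exact: measurable_funX.
Qed.

Lemma measurable_fun_sqrt (f : T -> R) : measurable_fun setT f ->
  measurable_fun setT (fun w => Num.sqrt (f w)).
Proof.
move=> mf; apply: (measurableT_comp _ mf).
apply: continuous_measurable_fun; exact: sqrt_continuous.
Qed.

Lemma measurable_fun_lt_set (f g : T -> R) : measurable_fun setT f ->
  measurable_fun setT g -> measurable [set w | f w < g w].
Proof.
move=> mf mg; rewrite (_ : mkset _ = (fun w => f w < g w) @^-1` [set true])//.
rewrite -[X in measurable X]setTI; exact: measurable_fun_ltr.
Qed.

Lemma measurable_fun_le_set (f g : T -> R) : measurable_fun setT f ->
  measurable_fun setT g -> measurable [set w | f w <= g w].
Proof.
move=> mf mg; rewrite (_ : mkset _ = (fun w => f w <= g w) @^-1` [set true])//.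
rewrite -[X in measurable X]setTI; exact: measurable_fun_ler.
Qed.

Lemma measurable_l2norm (n : nat) (f : T -> 'cV[R]_n) :
  (forall k, measurable_fun setT (fun w => f w k 0)) ->
  measurable_fun setT (fun w => l2norm (f w)).
Proof.
move=> mf; apply: measurable_fun_sqrt; apply: measurable_sum => k.
exact: measurable_funX.
Qed.

Lemma measurable_l1norm (n : nat) (f : T -> 'cV[R]_n) :
  (forall k, measurable_fun setT (fun w => f w k 0)) ->
  measurable_fun setT (fun w => l1norm (f w)).
Proof.
move=> mf; apply: measurable_sum => k.
by apply: measurableT_comp => //; exact: mf.
Qed.

Lemma measurable_mulmx (m n p : nat) (g : T -> 'M[R]_(m, n)) (f : T -> 'M[R]_(n, p)) :
  (forall i k, measurable_fun setT (fun w => g w i k)) ->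
  (forall k j, measurable_fun setT (fun w => f w k j)) ->
  forall i j, measurable_fun setT (fun w => (g w *m f w) i j).
Proof.
move=> mg mf i j; under eq_fun do rewrite mxE.
by apply: measurable_sum => k; exact: measurable_funM.
Qed.

Lemma measurable_finite_union (I : finType) (E : I -> set T) (F : set T) :
  (forall i, measurable (E i)) -> (forall w, F w <-> exists i, E i w) ->
  measurable F.
Proof.
move=> mE FE; rewrite (_ : F = \bigcup_(i in setT) E i).
  by apply: fin_bigcup_measurable => //; exact: finite_finset.
by apply/seteqP; split => w; [move=> /FE[i Ei]; exists i|case=> i _ Ei; apply/FE; exists i].
Qed.

Lemma measurable_finite_inter (I : finType) (E : I -> set T) (F : set T) :
  (forall i, measurable (E i)) -> (forall w, F w <-> forall i, E i w) ->
  measurable F.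
Proof.
move=> mE FE; rewrite (_ : F = \bigcap_(i in setT) E i).
  by apply: fin_bigcap_measurable => //; exact: finite_finset.
by apply/seteqP; split => w; [move=> /FE h i _; exact: h|move=> h; apply/FE => i; exact: h].
Qed.

End Measurability.

(** * Weighted union bounds, and tails of an exponential variable *)

Section Prob.
Context (disp : measure_display) (T : measurableType disp) (R : realType).
Variable P : probability T R.

Definition prob (E : set T) : R := fine (P E).

Lemma probE (E : set T) : measurable E -> P E = (prob E)%:E.
Proof. by move=> mE; rewrite /prob fineK// fin_num_measure. Qed.

Lemma prob_ge0 (E : set T) : 0 <= prob E.
Proof. exact/fine_ge0/measure_ge0. Qed.

Lemma probT : prob setT = 1.
Proof. by rewrite /prob probability_setT. Qed.

Lemma prob_setC (E : set T) : measurable E -> prob (~` E) = 1 - prob E.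
Proof.
by move=> mE; rewrite {1}/prob probability_setC// probE.
Qed.

Lemma integral_sum_indic (I : finType) (c : I -> R) (E : I -> set T) :
  (forall i, 0 <= c i) -> (forall i, measurable (E i)) ->
  (\int[P]_w (\sum_i c i * \1_(E i) w)%:E = (\sum_i c i * prob (E i))%:E)%E.
Proof.
move=> c0 mE.
under eq_integral do rewrite -sumEFin.
rewrite ge0_integral_sum//=; last first.
- by move=> i w _; rewrite lee_fin mulr_ge0.
- by move=> i; apply/measurable_EFinP; apply: measurable_funM => //; exact: measurable_indic.
rewrite -sumEFin; apply: eq_bigr => i _.
under eq_integral do rewrite EFinM.
rewrite ge0_integralZl//=.
- by rewrite integral_indic// setIT EFinM -probE.
- by apply/measurable_EFinP; exact: measurable_indic.
- by rewrite lee_fin.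
Qed.

Lemma measurable_sum_indic (I : finType) (c : I -> R) (E : I -> set T) :
  (forall i, measurable (E i)) ->
  measurable_fun setT (fun w => \sum_i c i * \1_(E i) w).
Proof.
by move=> mE; apply: measurable_sum => i; apply: measurable_funM.
Qed.

(** Markov's inequality for a weighted sum of indicators. The heavy, light and lower tail bounds all
    reduce to it: functions of the [u_k] are first replaced by step functions, so the infinite mean
    of [1 / u_k] never enters. *)
Lemma weighted_union_bound (I : finType) (c : I -> R) (E : I -> set T) (F : set T) :
  (forall i, 0 <= c i) -> (forall i, measurable (E i)) -> measurable F ->
  (forall w, F w -> 1 <= \sum_i c i * \1_(E i) w) ->
  prob F <= \sum_i c i * prob (E i).
Proof.
move=> c0 mE mF h; rewrite -lee_fin -probE// -integral_sum_indic//.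
rewrite -(setIT F) -integral_indic//; apply: ge0_le_integral => //=.
- by apply/measurable_EFinP; exact: measurable_indic.
- by apply/measurable_EFinP; exact: measurable_sum_indic.
- move=> w _; rewrite lee_fin indicE; have [|] := boolP (w \in F).
    by rewrite inE => /h.
  by move=> _; apply: sumr_ge0 => i _; rewrite mulr_ge0.
Qed.

(** The other direction: a pointwise bound passes to the expectation. It serves as a discrete Fubini
    argument when the sketch is conditioned on [D]. *)
Lemma weighted_prob_le (I : finType) (c : I -> R) (E : I -> set T) (C : R) :
  (forall i, 0 <= c i) -> (forall i, measurable (E i)) ->
  (forall w, \sum_i c i * \1_(E i) w <= C) ->
  \sum_i c i * prob (E i) <= C.
Proof.
move=> c0 mE h; rewrite -lee_fin -integral_sum_indic//.
rewrite (_ : C%:E = \int[P]_w (cst C%:E w))%E; last first.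
  by rewrite integral_cst// (_ : _ setT = 1%E) ?mule1//; exact: probability_setT P.
apply: ge0_le_integral => //=.
- by move=> w _; rewrite lee_fin sumr_ge0// => i _; rewrite mulr_ge0.
- by apply/measurable_EFinP; exact: measurable_sum_indic.
- by move=> w _; rewrite lee_fin; exact: h.
Qed.

Lemma prob_le (E F : set T) : measurable E -> measurable F -> E `<=` F ->
  prob E <= prob F.
Proof.
move=> mE mF EF; rewrite -lee_fin -!probE//.
by apply: le_measure; rewrite ?inE.
Qed.

Lemma prob_union_bound (I : finType) (E : I -> set T) (F : set T) :
  (forall i, measurable (E i)) -> measurable F ->
  (forall w, F w -> exists i, E i w) ->
  prob F <= \sum_i prob (E i).
Proof.
move=> mE mF h; under eq_bigr do rewrite -[prob _]mul1r.
apply: weighted_union_bound => // w /h[i Ei].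
by rewrite (bigD1 i)//= indicE mem_set// mulr1 lerDl sumr_ge0// => j _; rewrite mul1r.
Qed.

Lemma prob_setU (E F : set T) : measurable E -> measurable F ->
  prob (E `|` F) <= prob E + prob F.
Proof.
move=> mE mF; rewrite -lee_fin EFinD -!probE//; last exact: measurableU.
exact: measureU2.
Qed.

Section Exponential.
Variable X : {RV P >-> R}.
Hypothesis expX : standard_exponential X.

Lemma exponential_lt0 : prob [set w | X w < 0] = 0.
Proof.
rewrite /prob (_ : mkset _ = X @^-1` `]-oo, 0[%classic); last first.
  by apply/seteqP; split => w /=; rewrite in_itv.
rewrite (_ : P _ = distribution P X `]-oo, 0[%classic)// expX//.
rewrite /exponential_prob integral0_eq// => x /=; rewrite in_itv/= => x0.
by rewrite lt0_exponential_pdf.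
Qed.

Lemma exponential_itv (x : R) : 0 < x ->
  prob [set w | 0 <= X w <= x] = 1 - expR (- x).
Proof.
move=> x0; rewrite /prob (_ : mkset _ = X @^-1` `[0, x]%classic); last first.
  by apply/seteqP; split => w /=; rewrite in_itv.
rewrite (_ : P _ = distribution P X `[0, x]%classic)// expX//.
by rewrite exponential_prob_itv0c// mulN1r.
Qed.

Lemma exponential_cdf_pos (x : R) : 0 < x ->
  prob [set w | X w <= x] = 1 - expR (- x).
Proof.
move=> x0; apply/le_anti/andP; split.
  rewrite -exponential_itv// -[leRHS]add0r -{1}exponential_lt0.
  have m1 : measurable [set w | X w < 0] by exact: measurable_fun_lt_set.
  have m2 : measurable [set w | 0 <= X w <= x].
    rewrite (_ : mkset _ = X @^-1` `[0, x]%classic); last first.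
      by apply/seteqP; split => w /=; rewrite in_itv.
    by rewrite -[X in measurable X]setTI; exact: measurable_funPT.
  apply: le_trans (prob_setU m1 m2); apply: prob_le.
  - exact: measurable_fun_le_set.
  - exact: measurableU.
  - by move=> w /= Xx; have [X0|X0] := ltP (X w) 0; [left|right; apply/andP].
rewrite -exponential_itv//; apply: prob_le.
- rewrite (_ : mkset _ = X @^-1` `[0, x]%classic); last first.
    by apply/seteqP; split => w /=; rewrite in_itv.
  by rewrite -[X in measurable X]setTI; exact: measurable_funPT.
- exact: measurable_fun_le_set.
- by move=> w /= /andP[].
Qed.

Lemma exponential_cdf (x : R) : 0 <= x ->
  prob [set w | X w <= x] = 1 - expR (- x).
Proof.
rewrite le_eqVlt => /predU1P[<-|]; last exact: exponential_cdf_pos.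
rewrite oppr0 expR0 subrr; apply/le_anti; rewrite prob_ge0 andbT.
(* At [x = 0], the event is contained in [X <= e], of probability at most [e], for every [e > 0]. *)
apply/ler_addgt0Pr => e e0; rewrite add0r.
apply: (@le_trans _ _ (prob [set w | X w <= e])).
  apply: prob_le; [exact: measurable_fun_le_set|exact: measurable_fun_le_set|].
  by move=> w /= /le_trans; apply; exact: ltW.
by rewrite exponential_cdf_pos//; have := expR_ge1Dx (- e); lra.
Qed.

(** From [1 - exp (- x) <= x]. This is the source of the [1 / x] tail of the scaling factors
    [1 / |u_k|]. *)
Lemma exponential_small_ball (x : R) : 0 <= x ->
  prob [set w | `|X w| <= x] <= x.
Proof.
move=> x0; apply: (@le_trans _ _ (prob [set w | X w <= x])).
  apply: prob_le; last by move=> w /=; exact/le_trans/ler_norm.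
    by apply: measurable_fun_le_set => //; exact: measurableT_comp.
  exact: measurable_fun_le_set.
by rewrite exponential_cdf//; have := expR_ge1Dx (- x); lra.
Qed.

Lemma exponential_tail (x : R) : 0 <= x ->
  prob [set w | x < X w] = expR (- x).
Proof.
move=> x0; have -> : [set w | x < X w] = ~` [set w | X w <= x].
  by apply/seteqP; split => w /=; rewrite ltNge => /negP.
by rewrite prob_setC ?exponential_cdf//; [lra|exact: measurable_fun_le_set].
Qed.

End Exponential.
End Prob.

(** * Tail bounds *)

Section Dyadic.
Context (R : realType).

(** For [X] standard exponential, the left side is the mean of the function equal to
    [exp (- max (b, 1))] on [X <= b] and to [1] elsewhere. It is one factor of the Laplace transform
    in [weighted_l2_lower_tail]. *)
Lemma two_valued_laplace (b : R) : 0 <= b ->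
  expR (- Num.max b 1) * (1 - expR (- b)) + expR (- b) <= expR (- (b / 6)).
Proof.
move=> b0; have eb : 0 < expR (- b) by exact: expR_gt0.
(* For [b >= 2] the left side is at most [2 exp (- b)], and [exp (5 b / 6) >= 2]. For [b < 2] it is
   at most [(1 + 1 / (1 + b)) / 2 = 1 - b / (2 (1 + b)) <= 1 - b / 6], which explains the [6]. *)
have [b2|b2] := leP 2 b.
  rewrite max_l; last by lra.
  have -> : - b = - (b / 6) + - (5 / 6 * b) by field.
  rewrite expRD; set x := expR (- (b / 6)); set z := expR (- (5 / 6 * b)).
  have z2 : z <= 1 / 2.
    rewrite /z expRN div1r lef_pV2 ?posrE ?expR_gt0//.
    by apply: le_trans (expR_ge1Dx _); lra.
  have z0 : 0 < z by exact: expR_gt0.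
  have x0 : 0 < x by exact: expR_gt0.
  by nra.
have p2 : expR (- Num.max b 1) <= 1 / 2.
  rewrite expRN div1r lef_pV2 ?posrE ?expR_gt0//.
  apply: le_trans (expR_ge1Dx _).
  have : 1 <= Num.max b 1 by rewrite le_max lexx orbT.
  by lra.
have h1 := expR_ge1Dx (- (b / 6)).
have h2 : expR (- b) * (1 + b) <= 1.
  rewrite expRN -ler_pdivlMl ?invr_gt0 ?expR_gt0// invrK mulr1.
  exact: expR_ge1Dx.
by nra.
Qed.

(** The value [v = 0] is excluded by the hypothesis, because then [a / v = 0]. *)
Lemma ltr_div_swap (x a v : R) : 0 < x -> 0 <= v -> x < a / v -> v <= a / x.
Proof.
move=> x0; rewrite le_eqVlt => /predU1P[<-|v0].
  by rewrite invr0 mulr0 => /(lt_trans x0); rewrite ltxx.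
by rewrite ltr_pdivlMr// => xv; rewrite ler_pdivlMr// mulrC ltW.
Qed.

(** The active layer with the largest index has [2^j tau < X <= 2^(j+1) tau], so its term alone is
    at least [X]. *)
Lemma heavy_layers (J : nat) (tau X : R) : 0 < tau -> tau < X -> X <= 2 ^+ J * tau ->
  X <= \sum_(j < J) (2 ^+ j.+1 * tau) * (2 ^+ j * tau < X)%R%:R.
Proof.
move=> tau0 tX; elim: J => [|J IH] XJ.
  by move: XJ; rewrite mul1r => /(lt_le_trans tX); rewrite ltxx.
rewrite big_ord_recr/=; have [XJ'|XJ'] := leP X (2 ^+ J * tau).
  by rewrite mulr0 addr0 IH.
rewrite mulr1 -[leLHS]add0r lerD// sumr_ge0// => j _.
by rewrite mulr_ge0// mulr_ge0// ?exprn_ge0// ltW.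
Qed.

(** Here the active layer with the smallest index pays for [X^2]; the first summand covers an [X]
    below all layers. *)
Lemma light_layers (J : nat) (tau X : R) : 0 < tau -> 0 <= X -> X <= tau ->
  X ^+ 2 <= ((2^-1) ^+ J * tau) ^+ 2 +
    \sum_(j < J) ((2^-1) ^+ j * tau) ^+ 2 * ((2^-1) ^+ j.+1 * tau < X)%R%:R.
Proof.
move=> tau0 X0 tX; elim: J => [|J IH].
  by rewrite big_ord0 addr0 mul1r ler_sqr// nnegrE ltW.
have s0 : 0 <= \sum_(j < J) ((2^-1) ^+ j * tau) ^+ 2 * ((2^-1) ^+ j.+1 * tau < X)%R%:R.
  by apply: sumr_ge0 => j _; rewrite mulr_ge0// sqr_ge0.
rewrite big_ord_recr/=; have [XJ'|XJ'] := leP X (2^-1 ^+ J.+1 * tau).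
  rewrite mulr0 addr0 -[leLHS]addr0 lerD// ler_sqr ?nnegrE//.
  exact: le_trans XJ'.
by rewrite mulr1; apply: le_trans IH _; rewrite addrC lerDr// sqr_ge0.
Qed.

Lemma geometric_half_le2 (J : nat) : \sum_(j < J) (2^-1 : R) ^+ j <= 2.
Proof.
suff -> : \sum_(j < J) (2^-1 : R) ^+ j = 2 - 2 * 2^-1 ^+ J.
  have h : 0 <= (2^-1 : R) ^+ J by rewrite exprn_ge0.
  by lra.
elim: J => [|J IH]; first by rewrite big_ord0 mulr1 subrr.
by rewrite big_ord_recr/= IH exprS; field.
Qed.

End Dyadic.

Section Tails.
Context (disp : measure_display) (T : measurableType disp) (R : realType).
Variable P : probability T R.

Section Truncation.
Context (I : finType) (a : I -> R) (U : I -> T -> R).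
Hypothesis a0 : forall i, 0 <= a i.
Hypothesis mU : forall i, measurable_fun setT (U i).
Hypothesis smallU : forall i y, 0 <= y -> prob P [set w | `|U i w| <= y] <= y.

Lemma measurable_ball_event i (y : R) : measurable [set w | `|U i w| <= y].
Proof. by apply: measurable_fun_le_set => //; exact: measurableT_comp. Qed.

(** The first term bounds the probability that some ratio exceeds [2^J tau]. Below that level layer
    [j] has expected mass at most [2^(j+1) tau * a_i / (2^j tau) = 2 a_i], so [J] layers give
    [2 J a_i], and Markov divides by [beta]. *)
Lemma heavy_part_tail (J : nat) (tau beta : R) : 0 < tau -> 0 < beta ->
  measurable [set w | beta < \sum_i
     (if tau < a i / `|U i w| then a i / `|U i w| else 0)] ->
  prob P [set w | beta < \sum_i
     (if tau < a i / `|U i w| then a i / `|U i w| else 0)] <=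
  (\sum_i a i) / (2 ^+ J * tau) + 2 * J%:R * (\sum_i a i) / beta.
Proof.
move=> t0 b0 mF.
(* Left indices are the overflow events, each of weight [1]; right indices are the layers, scaled by
   [1 / beta] so that mass [beta] means total weight [1]. *)
pose c (z : I + I * 'I_J) := match z with inl _ => 1
   | inr ij => 2 ^+ (ij.2).+1 * tau / beta end.
pose E (z : I + I * 'I_J) := match z with
   | inl i => [set w | `|U i w| <= a i / (2 ^+ J * tau)]
   | inr ij => [set w | `|U ij.1 w| <= a ij.1 / (2 ^+ (ij.2) * tau)] end.
have p2 j : 0 < 2 ^+ j * tau by rewrite mulr_gt0// exprn_gt0.
have c0 z : 0 <= c z.
  by case: z => //= -[i j]; rewrite divr_ge0 ?ltW.
have mE z : measurable (E z) by case: z => [i|[i j]]; exact: measurable_ball_event.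
apply: le_trans (weighted_union_bound P c0 mE mF _) _.
  move=> w /= Fw; rewrite big_sumType/=.
  have S0 : 0 <= \sum_i c (inl i) * \1_(E (inl i)) w by apply: sumr_ge0 => i _; rewrite mulr_ge0.
  have S1 : 0 <= \sum_ij c (inr ij) * \1_(E (inr ij)) w.
    by apply: sumr_ge0 => i _; rewrite mulr_ge0.
  have [[i hi]|/forallNP hX] := pselect (exists i, 2 ^+ J * tau < a i / `|U i w|).
    rewrite -[leLHS]addr0 lerD// (bigD1 i)//= indicE mem_set ?mulr1 ?lerDl//=.
      by apply: sumr_ge0 => j _; rewrite mulr_ge0.
    exact: ltr_div_swap hi.
  rewrite -[leLHS]add0r lerD// -(pair_bigA _ (fun i j => c (inr (i, j)) * \1_(E (inr (i, j))) w))/=.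
  rewrite -(@ler_pM2l _ beta)// mulr1; apply: le_trans (ltW Fw) _.
  rewrite mulr_sumr; apply: ler_sum => i _.
  have T0 : 0 <= \sum_(j < J) 2 ^+ j.+1 * tau / beta * \1_(E (inr (i, j))) w.
    by apply: sumr_ge0 => j _; rewrite mulr_ge0// divr_ge0 ?ltW.
  case: ifPn => [tX|_]; last by rewrite mulr_ge0// ltW.
  have XJ : a i / `|U i w| <= 2 ^+ J * tau by rewrite leNgt; apply/negP/hX.
  apply: le_trans (heavy_layers t0 tX XJ) _.
  rewrite mulr_sumr; apply: ler_sum => j _.
  rewrite mulrA mulrCA divff ?gt_eqF// mulr1 ler_pM2l// indicE ler_nat.
  case: ltP => //= Xj; rewrite mem_set//=.
  exact: ltr_div_swap Xj.
rewrite big_sumType/= lerD//.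
  rewrite mulr_suml; apply: ler_sum => i _; rewrite mul1r smallU//.
  by rewrite divr_ge0// ltW.
rewrite -(pair_bigA _ (fun i j => c (inr (i, j)) * prob P (E (inr (i, j)))))/=.
rewrite mulr_sumr mulr_suml; apply: ler_sum => i _.
rewrite [leRHS](_ : _ = \sum_(j < J) 2 * a i / beta); last first.
  by rewrite sumr_const card_ord -mulr_natr; ring.
apply: ler_sum => j _.
apply: (@le_trans _ _ (2 ^+ j.+1 * tau / beta * (a i / (2 ^+ j * tau)))).
  apply: ler_wpM2l; first exact: (c0 (inr (i, j))).
  by apply: smallU; rewrite divr_ge0// ltW.
rewrite exprS le_eqVlt; apply/orP; left; apply/eqP.
have := p2 j; rewrite pmulr_lgt0// => q0.
by field; rewrite !gt_eqF.
Qed.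

(** Layer [j] has expected squared mass at most [(2^-j tau)^2 * a_i / (2^-(j+1) tau) = 2 tau a_i
    2^-j]; the geometric series turns this into [4 tau a_i]. The mass below the last layer is
    charged deterministically, through the event [setT]. *)
Lemma light_part_tail (J : nat) (tau beta : R) : 0 < tau -> 0 < beta ->
  measurable [set w | beta < \sum_i
     (if a i / `|U i w| <= tau then (a i / `|U i w|) ^+ 2 else 0)] ->
  prob P [set w | beta < \sum_i
     (if a i / `|U i w| <= tau then (a i / `|U i w|) ^+ 2 else 0)] <=
  (#|I|%:R * ((2^-1) ^+ J * tau) ^+ 2 + 4 * tau * \sum_i a i) / beta.
Proof.
move=> t0 b0 mF.
pose c (z : I + I * 'I_J) := match z with inl _ => ((2^-1) ^+ J * tau) ^+ 2 / beta
   | inr ij => ((2^-1) ^+ ij.2 * tau) ^+ 2 / beta end.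
pose E (z : I + I * 'I_J) := match z with
   | inl i => setT
   | inr ij => [set w | `|U ij.1 w| <= a ij.1 / ((2^-1) ^+ (ij.2).+1 * tau)] end.
have p2 j : 0 < (2^-1) ^+ j * tau by rewrite mulr_gt0// exprn_gt0.
have c0 z : 0 <= c z.
  by case: z => [i|[i j]]; rewrite divr_ge0 ?ltW// exprn_gt0.
have mE z : measurable (E z).
  by case: z => [i|[i j]]; [exact: measurableT|exact: measurable_ball_event].
apply: le_trans (weighted_union_bound P c0 mE mF _) _.
  move=> w /= Fw; rewrite big_sumType/=.
  rewrite -(pair_bigA _ (fun i j => c (inr (i, j)) * \1_(E (inr (i, j))) w))/=.
  rewrite -big_split/= -(@ler_pM2l _ beta)// mulr1; apply: le_trans (ltW Fw) _.
  rewrite mulr_sumr; apply: ler_sum => i _.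
  rewrite indicE mem_set// mulr1 mulrDr mulrCA divff ?gt_eqF// mulr1.
  have T0 : 0 <= beta * \sum_(j < J) (2^-1 ^+ j * tau) ^+ 2 / beta * \1_(E (inr (i, j))) w.
    apply: mulr_ge0; [exact: ltW|apply: sumr_ge0 => j _; apply: mulr_ge0 => //].
    exact: (c0 (inr (i, j))).
  case: ifPn => [tX|_]; last by rewrite addr_ge0// sqr_ge0.
  have X0 : 0 <= a i / `|U i w| by rewrite divr_ge0.
  apply: le_trans (light_layers J t0 X0 tX) _.
  rewrite lerD2l mulr_sumr; apply: ler_sum => j _.
  rewrite mulrA mulrCA divff ?gt_eqF// mulr1 ler_wpM2l ?sqr_ge0// indicE ler_nat.
  case: ltP => //= Xj; rewrite mem_set//=.
  exact: ltr_div_swap Xj.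
rewrite big_sumType/= mulrDl lerD//.
  rewrite -mulr_suml sumr_const probT mulr1 le_eqVlt; apply/orP; left; apply/eqP.
  by rewrite -[(_ / _) *+ _]mulr_natr; ring.
rewrite -(pair_bigA _ (fun i j => c (inr (i, j)) * prob P (E (inr (i, j)))))/=.
rewrite mulr_sumr mulr_suml; apply: ler_sum => i _.
apply: (@le_trans _ _ (\sum_(j < J) (2 * tau * a i / beta) * 2^-1 ^+ j)).
  apply: ler_sum => j _.
  apply: (@le_trans _ _ ((2^-1 ^+ j * tau) ^+ 2 / beta * (a i / (2^-1 ^+ j.+1 * tau)))).
    apply: ler_wpM2l; first exact: (c0 (inr (i, j))).
    by apply: smallU; rewrite divr_ge0// ltW.
  rewrite [2^-1 ^+ j.+1]exprS le_eqVlt; apply/orP; left; apply/eqP.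
  have := p2 j; rewrite pmulr_lgt0//; move: (2^-1 ^+ j) => q q0.
  by field; rewrite !gt_eqF.
rewrite -mulr_sumr.
apply: (@le_trans _ _ ((2 * tau * a i / beta) * 2)).
  rewrite ler_wpM2l ?geometric_half_le2//.
  by rewrite divr_ge0// ?mulr_ge0// ltW.
by rewrite le_eqVlt; apply/orP; left; apply/eqP; ring.
Qed.

End Truncation.
End Tails.

(** * Lower tail of a weighted sum of inverse squares *)

Section LowerTail.
Context (disp : measure_display) (T : measurableType disp) (R : realType).
Variable P : probability T R.
Context (n : nat) (u : 'I_n -> {RV P >-> R}).
Hypothesis iidu : iid_standard_exponential u.

Lemma measurable_preimage (i : 'I_n) (B : set R) : measurable B ->
  measurable (u i @^-1` B).
Proof. by move=> mB; rewrite -[X in measurable X]setTI; exact: measurable_funPT. Qed.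

Lemma measurable_box (B : 'I_n -> set R) : (forall i, measurable (B i)) ->
  measurable (\bigcap_i (u i @^-1` B i)).
Proof.
move=> mB; apply: fin_bigcap_measurable; first exact: finite_finset.
by move=> i _; exact: measurable_preimage.
Qed.

Lemma prob_box (B : 'I_n -> set R) : (forall i, measurable (B i)) ->
  prob P (\bigcap_i (u i @^-1` B i)) = \prod_i prob P (u i @^-1` B i).
Proof.
move=> mB; have [ind _] := iidu.
have := ind [set: 'I_n]%SET B (fun i _ => mB i).
rewrite (_ : [set` [set: 'I_n]%SET] = setT); last first.
  by apply/seteqP; split => i //= _; rewrite inE.
rewrite probE; last exact: measurable_box.
rewrite (eq_bigr (fun i => (prob P (u i @^-1` B i))%:E)); last first.
  by move=> i _; apply: probE; exact: measurable_preimage.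
by rewrite prodEFin => -[->]; apply: eq_bigl => i; rewrite inE.
Qed.

(* Laplace transform at [lambda = t^2 L], with [exp (- lambda a_k^2 / u_k^2)]
   replaced by the two-valued function of [u_k] that jumps at [t a_k]. *)
Lemma weighted_l2_lower_tail (a : 'I_n -> R) (L t : R) (F : set T) :
  (forall i, 0 <= a i) -> \sum_i a i = 1 -> 1 <= L -> 0 < t -> measurable F ->
  (forall w, F w -> (forall k, 0 < u k w /\ (u k w <= L \/ t <= L)) /\
     \sum_k (a k / u k w) ^+ 2 < (12 * t * L)^-1) ->
  prob P F <= expR (- (t / 12)).
Proof.
move=> a0 a1 L1 t0 mF hF; have [_ expu] := iidu.
pose b k := t * a k.
have b0 k : 0 <= b k by rewrite mulr_ge0// ltW.
pose p k := expR (- Num.max (b k) 1).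
pose g k (x : bool) := if x then p k else 1.
pose B k (x : bool) : set R := if x then `]-oo, b k]%classic else `]b k, +oo[%classic.
have mB k x : measurable (B k x) by rewrite /B; case: x.
(* The pattern [f] records which [u_k] are at most [b k]. The boxes [E f] partition the sample
   space, so the weighted sum of indicators is [exp (t / 12)] times the product of the two-valued
   functions. *)
pose c (f : {ffun 'I_n -> bool}) := expR (t / 12) * \prod_k g k (f k).
pose E (f : {ffun 'I_n -> bool}) := \bigcap_k (u k @^-1` B k (f k)).
have g0 k x : 0 < g k x by rewrite /g; case: x => //; exact: expR_gt0.
have c0 f : 0 <= c f.
  by rewrite mulr_ge0 ?expR_ge0// prodr_ge0// => k _; exact: ltW.
have mE f : measurable (E f) by exact: measurable_box.
apply: le_trans (weighted_union_bound P c0 mE mF _) _.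
  move=> w /hF[uP sL].
  pose f := [ffun k => u k w <= b k].
  have Ef : E f w.
    move=> k _ /=; rewrite /B ffunE; case: leP => h /=; rewrite in_itv/= ?andbT//.
  rewrite (bigD1 f)//= indicE mem_set// mulr1 -[leLHS]addr0 lerD//; last first.
    by apply: sumr_ge0 => f' _; rewrite mulr_ge0.
  rewrite /c (_ : \prod_k _ = expR (- \sum_k if f k then Num.max (b k) 1 else 0)).
    rewrite -expRD -[leLHS]expR0 ler_expR subr_ge0.
    (* On [F] this sum is at most [t^2 L / (12 t L) = t / 12]. *)
    apply: (@le_trans _ _ (\sum_k (t ^+ 2 * L) * (a k / u k w) ^+ 2)); last first.
      rewrite -mulr_sumr; apply: le_trans (ler_wpM2l _ (ltW sL)) _.
        by rewrite mulr_ge0// ?sqr_ge0//; lra.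
      have L0 : L != 0 by rewrite gt_eqF//; lra.
      rewrite le_eqVlt; apply/orP; left; apply/eqP.
      by field; rewrite L0 gt_eqF.
    apply: ler_sum => k _; have [uk0 ukL] := uP k.
    case: ifPn => [|_]; last by rewrite mulr_ge0 ?sqr_ge0// mulr_ge0 ?sqr_ge0//; lra.
    rewrite ffunE => ukb.
    have ak1 : a k <= 1.
      by rewrite -a1 (bigD1 k)//= lerDl sumr_ge0.
    (* When [t <= L], the bound comes from [u_k <= t a_k <= t]. *)
    have ukL' : u k w <= L.
      case: ukL => // tL; apply: le_trans ukb _; apply: le_trans tL.
      by rewrite /b; nra.
    have -> : t ^+ 2 * L * (a k / u k w) ^+ 2 = (b k) ^+ 2 * L / (u k w) ^+ 2.
      by rewrite /b; field; rewrite gt_eqF.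
    rewrite ler_pdivlMr ?exprn_gt0//.
    have := b0 k; move: (b k) (u k w) ukb uk0 ukL' => bb uu h1 h2 h3 h4.
    (* If [b >= 1], then [b u^2 <= b^2 L] by [u <= b] and [u <= L]; if [b < 1], then [u^2 <= b^2 L]
       by [u <= b] and [1 <= L]. *)
    rewrite maxEge; case: (leP 1 bb) => h5.
      rewrite !expr2 -mulrA ler_wpM2l// mulrC.
      by apply: ler_pM => //; exact: ltW.
    rewrite mul1r -[leLHS]mulr1 ler_pM ?sqr_ge0// ler_sqr ?nnegrE//.
    exact: ltW.
  rewrite -sumrN expR_sum; apply: eq_bigr => k _; rewrite /g.
  by case: ifP => //; rewrite oppr0 expR0.
have prodE (f : {ffun 'I_n -> bool}) :
    c f * prob P (E f) = expR (t / 12) * \prod_k (g k (f k) * prob P (u k @^-1` B k (f k))).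
  by rewrite /c /E prob_box// -mulrA -big_split.
under eq_bigr do rewrite prodE.
(* By independence the sum over patterns is a product over [k] of two-term sums. As the [b k] add up
   to [t], the final exponent is [t / 12 - t / 6]. *)
rewrite -mulr_sumr -(bigA_distr_bigA (fun k x => g k x * prob P (u k @^-1` B k x))).
have -> : - (t / 12) = t / 12 + \sum_k - (b k / 6).
  by rewrite sumrN -mulr_suml -mulr_sumr a1; field.
rewrite expRD ler_wpM2l ?expR_ge0// expR_sum; apply: ler_prod => k _.
rewrite big_bool/= /g /p /B mul1r.
have -> : u k @^-1` `]-oo, b k]%classic = [set w | u k w <= b k].
  by apply/seteqP; split => w /=; rewrite in_itv.
have -> : u k @^-1` `]b k, +oo[%classic = [set w | b k < u k w].
  by apply/seteqP; split => w /=; rewrite in_itv/= ?andbT.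
rewrite (exponential_cdf (expu k))// (exponential_tail (expu k))//.
rewrite two_valued_laplace// andbT addr_ge0 ?expR_ge0// mulr_ge0 ?expR_ge0//.
by have := b0 k; rewrite subr_ge0 -oppr_le0 -ler_expR expR0.
Qed.

End LowerTail.

(** * Conditioning on the diagonal scaling *)

Definition embeds (R : realType) (m n : nat) (M : 'M[R]_(m, n)) (v : 'cV[R]_n) :=
  (1 / 2) * l2norm v <= l2norm (M *m v) <= (3 / 2) * l2norm v.

Lemma measurable_not_embeds (disp : measure_display) (T : measurableType disp)
  (R : realType) (m n : nat) (M : 'M[R]_(m, n)) (f : T -> 'cV[R]_n) :
  (forall k, measurable_fun setT (fun w => f w k 0)) ->
  measurable [set w | ~~ embeds M (f w)].
Proof.
move=> mf.
have m1 := measurable_l2norm mf.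
have m2 : measurable_fun setT (fun w => l2norm (M *m f w)).
  apply: measurable_l2norm => k; apply: measurable_mulmx => //.
  by move=> k' j; rewrite ord1.
rewrite (_ : mkset _ = [set w | l2norm (M *m f w) < 1 / 2 * l2norm (f w)] `|`
    [set w | 3 / 2 * l2norm (f w) < l2norm (M *m f w)]).
  by apply: measurableU; apply: measurable_fun_lt_set => //; exact: measurable_funM.
apply/seteqP; split => w /=; rewrite /embeds negb_and -!ltNge.
  by move=> /orP.
by move=> /orP.
Qed.

Section FiniteValued.
Context (disp : measure_display) (T : measurableType disp) (R : realType).
Variable P : probability T R.
Context (m n k d : nat) (S : T -> 'M[R]_(m, n)) (u : 'I_k -> {RV P >-> R}).
Context (I : finType) (Mv : I -> 'M[R]_(m, n)).
Hypothesis Mv_inj : injective Mv.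
Hypothesis S_Mv : forall w, exists i, S w = Mv i.
Hypothesis mS : forall i, measurable (S @^-1` [set Mv i]).
Hypothesis indepS : discrete_independent S u.
Hypothesis oseS : oblivious_subspace_embedding P d S.

Lemma measurable_entry i j : measurable_fun setT (fun w => S w i j).
Proof.
have -> : (fun w => S w i j) = (fun w => \sum_l Mv l i j * \1_(S @^-1` [set Mv l]) w).
  apply/funext => w; have [l Sl] := S_Mv w.
  rewrite (bigD1 l)//= indicE mem_set// mulr1 big1 ?addr0 ?Sl// => l' l'l.
  rewrite indicE memNset ?mulr0// => /= e; move: l'l.
  by rewrite -(inj_eq Mv_inj) -e Sl eqxx.
exact: measurable_sum_indic.
Qed.

(** As [S] has finitely many values, even a predicate quantifying over all vectors of a subspace
    gives a measurable event. *)
Lemma measurable_of_value (Q : 'M[R]_(m, n) -> Prop) : measurable [set w | Q (S w)].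
Proof.
apply: (@measurable_finite_union _ _ _
  (fun i => if pselect (Q (Mv i)) then S @^-1` [set Mv i] else set0)).
  by move=> i; case: pselect => Qi /=; [exact: mS|exact: measurable0].
move=> w; split => /=.
  by have [i Sw] := S_Mv w => QS; exists i; case: pselect => //; rewrite -Sw.
by case=> i; case: pselect => //= Qi ->.
Qed.

(** A pi-system generating the sigma-algebra of [u]. Measurability over [g_sigma_algebraType boxes]
    says that a quantity depends on the sample point only through [u]. *)
Definition boxes : set (set T) := [set E | exists2 B : 'I_k -> set R,
  (forall i, measurable (B i)) & E = \bigcap_i (u i @^-1` B i)].

Lemma boxesI : setI_closed boxes.
Proof.
move=> _ _ [B mB ->] [C mC ->]; exists (fun i => B i `&` C i).
  by move=> i; exact: measurableI.
apply/seteqP; split => w.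
  by move=> [h1 h2] i _; split; [exact: h1|exact: h2].
by move=> h; split => i _; have [] := h i Logic.I.
Qed.

Lemma boxes_measurable : boxes `<=` measurable.
Proof. by move=> _ [B mB ->]; exact: measurable_box. Qed.

Lemma boxesT : boxes setT.
Proof. by exists (fun=> setT) => //; apply/seteqP; split. Qed.

Lemma sigma_boxes_measurable (E : set T) : <<s boxes >> E -> measurable E.
Proof.
apply: smallest_sub; last exact: boxes_measurable.
exact: sigma_algebra_measurable.
Qed.

Lemma measurable_boxes_fun i :
  measurable_fun (T := g_sigma_algebraType boxes) setT (u i).
Proof.
move=> _ B mB; rewrite setTI; apply: sub_sigma_algebra.
exists (fun j => if j == i then B else setT); first by move=> j; case: ifP.
apply/seteqP; split => w /=.
  by move=> Bw j _ /=; case: eqVneq => // ->.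
by move=> /(_ i Logic.I) /=; rewrite eqxx.
Qed.

(** Pi-lambda argument: both sides are finite measures in [E] that agree on boxes. *)
Lemma independent_sigma_boxes (i : I) (E : set T) : <<s boxes >> E ->
  prob P (S @^-1` [set Mv i] `&` E) = prob P (S @^-1` [set Mv i]) * prob P E.
Proof.
move=> sE; have mE := sigma_boxes_measurable sE.
have p0 := prob_ge0 P (S @^-1` [set Mv i]).
have key : mrestr P (mS i) E = mscale (NngNum p0) P E.
  apply: (@g_sigma_algebra_measure_unique _ _ _ boxes boxes_measurable (fun=> setT)
    (fun=> boxesT) _ (mrestr P (mS i)) (mscale (NngNum p0) P) boxesI _ _ E sE).
  - by rewrite bigcup_const//; exists 0%N.
  - move=> _ [B mB ->].
    change (P (\bigcap_i0 (u i0 @^-1` B i0) `&` S @^-1` [set Mv i]) =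
      ((prob P (S @^-1` [set Mv i]))%:E * P (\bigcap_i0 (u i0 @^-1` B i0)))%E).
    by rewrite setIC indepS// probE.
  - move=> _; change (P (setT `&` S @^-1` [set Mv i]) < +oo)%E; rewrite setTI; apply: (le_lt_trans (probability_le1 _ _)) => //.
    by rewrite ltry.
apply: EFin_inj; rewrite EFinM -(probE P mE).
rewrite -probE; last exact: measurableI.
by rewrite setIC.
Qed.

(** This is the conditioning on [D]: the vectors [f j] are functions of [u], so for each fixed value
    of them the embedding property of the independent [S] applies to the subspace [W] containing
    them. *)
Lemma ose_random_family (J : finType) (f : J -> T -> 'cV[R]_n) :
  (forall j l, measurable_fun (T := g_sigma_algebraType boxes) setT (fun w => f j w l 0)) ->
  (forall w, exists2 W : {vspace 'cV[R]_n}, \dim W = d & forall j, f j w \in W) ->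
  measurable [set w | exists j, ~~ embeds (S w) (f j w)] /\
  prob P [set w | exists j, ~~ embeds (S w) (f j w)] <= 1 / 100.
Proof.
move=> mf fW.
pose Bad i := [set w | exists j, ~~ embeds (Mv i) (f j w)].
have sBad i : <<s boxes >> (Bad i).
  apply: (@measurable_finite_union _ (g_sigma_algebraType boxes) J
    (fun j => [set w | ~~ embeds (Mv i) (f j w)])) => //.
  by move=> j; apply: measurable_not_embeds => l; exact: mf.
have mBad i := sigma_boxes_measurable (sBad i).
have mF : measurable [set w | exists j, ~~ embeds (S w) (f j w)].
  apply: (@measurable_finite_union _ _ I (fun i => S @^-1` [set Mv i] `&` Bad i)).
    by move=> i; exact: measurableI.
  move=> w; split => /=; last by case=> i [/= ->].
  by have [i Sw] := S_Mv w => h; exists i; split => //; rewrite /Bad/= -Sw.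
split => //.
apply: (@le_trans _ _ (\sum_i prob P (S @^-1` [set Mv i] `&` Bad i))).
  apply: prob_union_bound => //; first by move=> i; exact: measurableI.
  move=> w /= h; have [i Sw] := S_Mv w; exists i; split => //.
  by rewrite /Bad/= -Sw.
under eq_bigr do rewrite independent_sigma_boxes//.
(* With weights [P(S = Mv i)] and events [Bad i], it suffices to bound, for each fixed [w], the
   total probability of the values of [S] that are bad for the vectors at [w]. *)
apply: weighted_prob_le => // [i|w]; first exact: prob_ge0.
have [W dW fWw] := fW w.
pose good (M : 'M[R]_(m, n)) := forall v : 'cV[R]_n, v \in W -> embeds M v.
pose Good := [set w' | good (S w')].
have mGood : measurable Good by exact: measurable_of_value.
have pGood : 99 / 100 <= prob P Good.
  by rewrite -lee_fin -probE//; exact: oseS.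
(* For fixed [w], the values that are bad at [w] are disjoint from each other and from [Good], so
   their probabilities and that of [Good] add up to at most [1]. The second sample point [w'] is the
   one at which [S] is evaluated. *)
pose c (z : I + unit) : R := match z with inl i => \1_(Bad i) w | inr _ => 1 end.
pose E (z : I + unit) := match z with inl i => S @^-1` [set Mv i] | inr _ => Good end.
have : \sum_z c z * prob P (E z) <= 1.
  apply: weighted_prob_le => [[i|[]]//|[i|[]]|w']; [exact: mS|exact: mGood|].
  rewrite big_sumType/= [X in _ + X](_ : _ = \1_Good w'); last first.
    rewrite (eq_bigr (fun=> \1_Good w')); first by rewrite sumr_const card_unit.
    by move=> [] _; rewrite mul1r.
  have [i Si] := S_Mv w'.
  rewrite (bigD1 i)//= big1 ?addr0; last first.
    move=> l li; rewrite [X in _ * X]indicE memNset ?mulr0// => /= e; move: li.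
    by rewrite -(inj_eq Mv_inj) -e Si eqxx.
  rewrite !indicE (mem_set (Si : (S @^-1` [set Mv i]) w')) mulr1.
  have [Bw|] := boolP (w \in Bad i); last by case: (w' \in Good) => _; rewrite add0r ?ler01.
  rewrite memNset ?addr0// => Gw; move: Bw; rewrite inE => -[j /negP]; apply.
  by rewrite -Si; apply: Gw; exact: fWw.
rewrite big_sumType/= [X in _ + X](_ : _ = prob P Good); last first.
  rewrite (eq_bigr (fun=> prob P Good)); first by rewrite sumr_const card_unit.
  by move=> [] _; rewrite mul1r.
move=> h; rewrite (eq_bigr (fun i => \1_(Bad i) w * prob P (S @^-1` [set Mv i]))).
  by lra.
by move=> i _; rewrite mulrC.
Qed.

End FiniteValued.

(** * Norms and the sparse sketch *)

Section Norms.
Context (R : realType).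

Lemma sqr_sum_le_card (I : finType) (x : I -> R) :
  (\sum_i x i) ^+ 2 <= #|I|%:R * \sum_i x i ^+ 2.
Proof.
rewrite expr2 mulr_suml.
apply: (@le_trans _ _ (\sum_i \sum_j (x i ^+ 2 / 2 + x j ^+ 2 / 2))).
  apply: ler_sum => i _; rewrite mulr_sumr; apply: ler_sum => j _.
  by have := sqr_ge0 (x i - x j); nra.
under eq_bigr do rewrite big_split/= sumr_const -mulr_suml -[X in X + _]mulr_natl.
by rewrite big_split/= sumr_const -mulr_sumr -!mulr_suml -[X in _ + X]mulr_natl -mulrDr -splitr.
Qed.

Lemma l1norm_ge0 n (v : 'cV[R]_n) : 0 <= l1norm v.
Proof. by apply: sumr_ge0. Qed.

Lemma l2norm_ge0 n (v : 'cV[R]_n) : 0 <= l2norm v.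
Proof. exact: sqrtr_ge0. Qed.

Lemma sqr_l2norm n (v : 'cV[R]_n) : l2norm v ^+ 2 = \sum_i v i 0 ^+ 2.
Proof. by rewrite sqr_sqrtr// sumr_ge0// => i _; exact: sqr_ge0. Qed.

Lemma l2norm_le_l1norm n (v : 'cV[R]_n) : l2norm v <= l1norm v.
Proof.
rewrite -ler_sqr ?nnegrE ?l2norm_ge0 ?l1norm_ge0// sqr_l2norm.
rewrite expr2 mulr_suml; apply: ler_sum => i _.
rewrite -real_normK ?num_real// expr2 ler_wpM2l//.
by rewrite /l1norm (bigD1 i)//= lerDl sumr_ge0.
Qed.

Lemma l1norm_le_l2norm n (v : 'cV[R]_n) : l1norm v <= Num.sqrt n%:R * l2norm v.
Proof.
rewrite -ler_sqr ?nnegrE ?mulr_ge0 ?sqrtr_ge0 ?l2norm_ge0 ?l1norm_ge0//.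
rewrite exprMn sqr_l2norm sqr_sqrtr//.
apply: le_trans (sqr_sum_le_card _) _; rewrite card_ord ler_wpM2l//.
by apply: ler_sum => i _; rewrite real_normK ?num_real.
Qed.

Lemma l1normD n (v w : 'cV[R]_n) : l1norm (v + w) <= l1norm v + l1norm w.
Proof.
by rewrite /l1norm -big_split/=; apply: ler_sum => i _; rewrite mxE ler_normD.
Qed.

Lemma l1normZ n (a : R) (v : 'cV[R]_n) : l1norm (a *: v) = `|a| * l1norm v.
Proof.
by rewrite /l1norm mulr_sumr; apply: eq_bigr => i _; rewrite mxE normrM.
Qed.

Lemma l1norm0 n : l1norm (0 : 'cV[R]_n) = 0.
Proof. by rewrite /l1norm big1// => i _; rewrite mxE normr0. Qed.

Lemma l1norm_sum n (I : finType) (f : I -> 'cV[R]_n) :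
  l1norm (\sum_i f i) <= \sum_i l1norm (f i).
Proof.
elim/big_ind2 : _ => //; first by rewrite l1norm0.
by move=> v a w b va wb; apply: le_trans (l1normD _ _) _; exact: lerD.
Qed.

Lemma mulmx_col_sum m n (M : 'M[R]_(m, n)) (x : 'cV[R]_n) :
  M *m x = \sum_j x j 0 *: col j M.
Proof.
apply/matrixP => i k; rewrite mxE summxE; apply: eq_bigr => j _.
by rewrite !mxE mulrC ord1.
Qed.

Lemma l1norm_mulmx m n (M : 'M[R]_(m, n)) (x : 'cV[R]_n) :
  l1norm (M *m x) <= \sum_j `|x j 0| * l1norm (col j M).
Proof.
rewrite mulmx_col_sum; apply: le_trans (l1norm_sum _) _.
by under eq_bigr do rewrite l1normZ.
Qed.

Lemma l1norm_mulmx_le m n (M : 'M[R]_(m, n)) (x : 'cV[R]_n) (C : R) :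
  (forall j, l1norm (col j M) <= C) -> l1norm (M *m x) <= C * l1norm x.
Proof.
move=> MC; apply: le_trans (l1norm_mulmx _ _) _.
rewrite /l1norm mulr_sumr; apply: ler_sum => j _.
by rewrite mulrC ler_wpM2r//; exact: MC.
Qed.

End Norms.

(** Induction on the missing dimension, adding at each step a vector picked in a complement. *)
Lemma extend_vspace (K : fieldType) (vT : vectType K) (U : {vspace vT}) (d : nat) :
  (\dim U <= d <= \dim {:vT})%N ->
  exists2 W : {vspace vT}, (U <= W)%VS & \dim W = d.
Proof.
move=> /andP[Ud dn]; move: {-1}(d - \dim U)%N (erefl (d - \dim U)%N) => k.
elim: k U Ud => [|k IH] U Ud dk.
  by exists U => //; apply/eqP; rewrite eqn_leq Ud -subn_eq0 dk.
have UC : (U^C)%VS != 0%VS.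
  apply/eqP => U0; have := dimv_compl U; rewrite U0 dimv0 => /esym/eqP.
  rewrite subn_eq0 => nU; have := leq_trans dn nU.
  by move=> dU; move: dk; rewrite (eqP dU).
pose v := vpick (U^C)%VS.
have v0 : v != 0 by rewrite vpick0.
have vU : v \notin U.
  apply/negP => vU; have : v \in (U :&: U^C)%VS by rewrite memv_cap vU memv_pick.
  by rewrite capv_compl memv0 (negPf v0).
have dUv : \dim (U + <[v]>) = (\dim U).+1.
  rewrite dimv_disjoint_sum ?dim_vline ?v0 ?addn1//.
  apply/eqP; rewrite -subv0; apply/subvP => x; rewrite memv_cap memv0.
  move=> /andP[xU /vlineP[a xa]]; have [a0|a0] := eqVneq a 0; first by rewrite xa a0 scale0r.
  by move: vU; rewrite -(scalerK a0 v) -xa rpredZ.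
have [||W UW dW] := IH (U + <[v]>)%VS.
- by rewrite dUv -subn_gt0 dk.
- by rewrite dUv subnS dk.
by exists W => //; apply: subv_trans UW; exact: addvSl.
Qed.

(** The embedding property concerns subspaces of dimension exactly [d], whereas [d] vectors may span
    less. The subspace [V] only supplies [d <= n], which leaves room for the extension. *)
Lemma sub_dim_family (R : realType) (n d : nat) (V : {vspace 'cV[R]_n}) (f : 'I_d -> 'cV[R]_n) :
  \dim V = d -> exists2 W : {vspace 'cV[R]_n}, \dim W = d & forall i, f i \in W.
Proof.
move=> dV; pose U := <<[seq f i | i <- enum 'I_d]>>%VS.
have [|W UW dW] := @extend_vspace _ _ U d.
  rewrite -{2}dV dimvS ?subvf// andbT; apply: leq_trans (dim_span _) _.
  by rewrite size_map size_enum_ord.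
exists W => // i; apply: (subvP UW); apply: memv_span.
by apply/mapP; exists i => //; rewrite mem_enum.
Qed.

(** * Values and column norms of the sparse sketch *)

Section SparseForm.
Context (disp : measure_display) (T : measurableType disp) (R : realType).
Variable P : probability T R.
Context (m s n : nat) (S : T -> 'M[R]_(\sum_(j < s) (m %/ s), n)).
Hypothesis formS : sparse_sign_form P S.

(** The matrix is a function of the finite configuration of rows and signs. Indexing by the codomain
    of that function makes the enumeration injective by construction. *)
Lemma sparse_finite_valued : exists (I : finType) (Mv : I -> 'M[R]_(\sum_(j < s) (m %/ s), n)),
  [/\ injective Mv, forall w, exists i, S w = Mv i &
      forall i, measurable (S @^-1` [set Mv i])].
Proof.
have [h [sg [Sform mhs]]] := formS.
pose cfg := {ffun 'I_s * 'I_n -> 'I_(m %/ s) * bool}.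
pose Mc (c : cfg) : 'M[R]_(\sum_(j < s) (m %/ s), n) := (Num.sqrt (s%:R : R))^-1 *:
  \mxcol_(j < s) sign_row_matrix R (fun k => (c (j, k)).1) (fun k => (c (j, k)).2).
pose cw w : cfg := [ffun jk => (h jk.1 jk.2 w, sg jk.1 jk.2 w)].
have ScM w : S w = Mc (cw w).
  rewrite Sform /Mc; congr (_ *: _); apply: eq_mxcol => j.
  by apply/matrixP => i k; rewrite !mxE !ffunE.
exists (seq_sub (codom Mc)), val; split; first exact: val_inj.
  move=> w; have Sw : S w \in codom Mc by rewrite ScM codom_f.
  by exists (SeqSub Sw).
move=> M; apply: (@measurable_finite_union _ _ cfg
  (fun c => if Mc c == val M then [set w | cw w = c] else set0)).
  move=> c; case: ifP => // _.
  apply: (@measurable_finite_inter _ _ ('I_s * 'I_n)%type (fun jk =>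
    [set w | h jk.1 jk.2 w = (c jk).1 /\ sg jk.1 jk.2 w = (c jk).2])).
    by move=> jk; have [] := mhs jk.1 jk.2 (c jk).1 (c jk).2.
  move=> w; split => [<- jk|hc] /=; first by rewrite ffunE.
  by apply/ffunP => jk; rewrite ffunE; have [-> ->] := hc jk; case: (c jk).
move=> w /=; split => [SM|[c]].
  by exists (cw w); rewrite -ScM SM eqxx.
by case: eqP => // <- /= <-; exact: ScM.
Qed.

(** Each of the [s] blocks contributes a single entry of size [1 / sqrt s]. *)
Lemma sparse_column_l1norm w k : l1norm (col k (S w)) = Num.sqrt s%:R.
Proof.
have [h [sg [Sform _]]] := formS.
have -> : l1norm (col k (S w)) = (Num.sqrt (s%:R : R))^-1 *
    \sum_(j < s) \sum_(i < m %/ s) `|sign_row_matrix R (fun k => h j k w) (fun k => sg j k w) i k|.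
  rewrite sig_big_dep/= (reindex _ tagnat.sig_bij_on)/= mulr_sumr.
  apply: eq_bigr => r _; rewrite Sform !mxE normrM ger0_norm//.
rewrite (eq_bigr (fun=> 1)); last first.
  move=> j _; rewrite (bigD1 (h j k w))//= mxE eqxx normr_sign big1 ?addr0//.
  by move=> i ih; rewrite mxE (negPf ih) normr0.
rewrite sumr_const card_ord -{2}(@sqr_sqrtr R s%:R)//.
have [->|s0] := eqVneq (Num.sqrt (s%:R : R)) 0; first by rewrite invr0 mul0r.
by field.
Qed.

End SparseForm.

(** * Deterministic distortion bounds *)

Section ForallMeasurable.
Context (disp : measure_display) (T : measurableType disp) (R : realType).

Lemma rational_approx (d : nat) (x : 'cV[R]_d) (e : R) : 0 < e ->
  exists q : 'cV[rat]_d, forall i, `|ratr (q i 0) - x i 0| <= e.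
Proof.
move=> e0.
have h i : exists q : rat, `|ratr q - x i 0| <= e.
  have [q] := @rat_in_itvoo R (x i 0 - e) (x i 0 + e) ltac:(lra).
  by rewrite in_itv/= => /andP[h1 h2]; exists q; rewrite ler_norml; lra.
have [f hf] := choice h.
by exists (\col_i f i) => i; rewrite mxE.
Qed.

(** A Lipschitz function is nonnegative everywhere as soon as it is so at rational points, so the
    event is a countable intersection. The Lipschitz constant may depend on [w]. *)
Lemma measurable_forall_lipschitz (d : nat) (g : T -> 'cV[R]_d -> R) :
  (forall x, measurable_fun setT (g ^~ x)) ->
  (forall w, exists K, forall x y, g w x - g w y <= K * l1norm (x - y)) ->
  measurable [set w | forall x, 0 <= g w x].
Proof.
move=> mg lg.
pose E (k : nat) : set T := if unpickle k is Some q then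
   [set w | 0 <= g w (map_mx ratr (q : 'cV[rat]_d))] else setT.
rewrite (_ : mkset _ = \bigcap_k E k).
  apply: bigcapT_measurable => k; rewrite /E; case: unpickle => // q.
  exact: measurable_fun_le_set.
apply/seteqP; split => w.
  by move=> h k _; rewrite /E; case: unpickle => // q; exact: h.
move=> h x /=; rewrite leNgt; apply/negP => gx.
have [K hK] := lg w.
(* This makes the error [|K| d e] strictly smaller than [- g w x]; the added ones keep the
   denominator positive when [K] or [d] is [0]. *)
pose e : R := - g w x / ((`|K| + 1) * (d%:R + 1)).
have K1 : 0 < `|K| + 1 by rewrite ltr_wpDl.
have d1 : 0 < d%:R + 1 :> R by rewrite ltr_wpDl.
have e0 : 0 < e by rewrite divr_gt0 ?oppr_gt0// mulr_gt0.
have [q hq] := rational_approx x e0.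
have gq : 0 <= g w (map_mx ratr q).
  by have := h (pickle q) Logic.I; rewrite /E pickleK.
have := hK (map_mx ratr q) x.
have l1 : l1norm (map_mx ratr q - x) <= d%:R * e.
  rewrite /l1norm -[d in d%:R]card_ord mulr_natl -sumr_const.
  by apply: ler_sum => i _; rewrite !mxE; exact: hq.
have l0 := l1norm_ge0 (map_mx ratr q - x).
have : K * l1norm (map_mx ratr q - x) <= `|K| * (d%:R * e).
  apply: (@le_trans _ _ (`|K| * l1norm (map_mx ratr q - x))).
    by rewrite ler_wpM2r// ler_norm.
  by rewrite ler_wpM2l.
have ee : e * ((`|K| + 1) * (d%:R + 1)) = - g w x.
  by rewrite /e; field; rewrite !gt_eqF.
have dd : 0 <= d%:R :> R by [].
have kk : 0 <= `|K| by [].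
have ke : 0 <= `|K| * e by rewrite mulr_ge0// ltW.
have de : 0 <= d%:R * e by rewrite mulr_ge0// ltW.
by nra.
Qed.

Lemma l1norm_distC d (x y : 'cV[R]_d) : l1norm (x - y) = l1norm (y - x).
Proof. by apply: eq_bigr => i _; rewrite !mxE distrC. Qed.

Lemma l1norm_lipschitz m d (M : 'M[R]_(m, d)) : exists2 K, 0 <= K & forall x y,
  l1norm (M *m x) - l1norm (M *m y) <= K * l1norm (x - y).
Proof.
exists (\sum_j l1norm (col j M)); first by apply: sumr_ge0 => j _; exact: l1norm_ge0.
move=> x y; rewrite lerBlDr -{1}(subrK y x) mulmxDr.
apply: le_trans (l1normD _ _) _; rewrite lerD2r; apply: l1norm_mulmx_le => j.
by rewrite (bigD1 j)//= lerDl sumr_ge0// => i _; exact: l1norm_ge0.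
Qed.

Lemma measurable_distortion m n d (M : T -> 'M[R]_(m, d)) (A : 'M[R]_(n, d)) (a b : R) :
  0 <= a -> 0 <= b ->
  (forall i k, measurable_fun setT (fun w => M w i k)) ->
  measurable [set w | forall x, a * l1norm (A *m x) <= l1norm (M w *m x) <= b * l1norm (A *m x)].
Proof.
move=> a0 b0 mM.
have mMx x : measurable_fun setT (fun w => l1norm (M w *m x)).
  by apply: measurable_l1norm => k; apply: measurable_mulmx.
have m1 : measurable [set w | forall x, 0 <= l1norm (M w *m x) - a * l1norm (A *m x)].
  apply: measurable_forall_lipschitz.
    by move=> x; apply: measurable_funB => //.
  move=> w; have [K K0 hK] := l1norm_lipschitz (M w).
  have [K' K0' hK'] := l1norm_lipschitz A.
  exists (K + a * K') => x y.
  have := hK x y; have := ler_wpM2l a0 (hK' y x).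
  rewrite (l1norm_distC y x).
  by move: (l1norm _) (l1norm (M w *m x)) (l1norm (M w *m y)) (l1norm (A *m y)) (l1norm (A *m x)) => *; lra.
have m2 : measurable [set w | forall x, 0 <= b * l1norm (A *m x) - l1norm (M w *m x)].
  apply: measurable_forall_lipschitz.
    by move=> x; apply: measurable_funB => //.
  move=> w; have [K K0 hK] := l1norm_lipschitz (M w).
  have [K' K0' hK'] := l1norm_lipschitz A.
  exists (K + b * K') => x y.
  have := hK y x; have := ler_wpM2l b0 (hK' x y).
  rewrite (l1norm_distC y x).
  by move: (l1norm _) (l1norm (M w *m x)) (l1norm (M w *m y)) (l1norm (A *m y)) (l1norm (A *m x)) => *; lra.
rewrite (_ : mkset _ = [set w | forall x, 0 <= l1norm (M w *m x) - a * l1norm (A *m x)] `&`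
  [set w | forall x, 0 <= b * l1norm (A *m x) - l1norm (M w *m x)]).
  exact: measurableI.
apply/seteqP; split => w /=.
  by move=> h; split => x; rewrite subr_ge0; have /andP[] := h x.
by move=> [h1 h2] x; rewrite -subr_ge0 h1 -subr_ge0 h2.
Qed.

End ForallMeasurable.

(** * Light and heavy entries, and the passage from a grid to all vectors *)

Section Deterministic.
Context (R : realType) (m n d : nat).

Definition light (tau : R) (Y : 'M[R]_(n, d)) : 'M[R]_(n, d) :=
  \matrix_(k, i) if `|Y k i| <= tau then Y k i else 0.

Definition heavy (tau : R) (Y : 'M[R]_(n, d)) : 'M[R]_(n, d) :=
  \matrix_(k, i) if tau < `|Y k i| then Y k i else 0.

Lemma light_heavy tau Y : Y = light tau Y + heavy tau Y.
Proof.
by apply/matrixP => k i; rewrite !mxE; case: leP => _; rewrite ?addr0 ?add0r.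
Qed.

(** Heavy entries are paid in the l1 norm, with factor [cs]. Light columns go through the l2 norm:
    [sqrt m] for the change of norm, [3 / 2] for the embedding, and Cauchy-Schwarz over the [d]
    columns. *)
Lemma sketch_upper_bound (M : 'M[R]_(m, n)) (Y : 'M[R]_(n, d)) (tau cs b1 b2 : R) :
  0 <= cs ->
  (forall k, l1norm (col k M) <= cs) ->
  (forall i, embeds M (col i (light tau Y))) ->
  \sum_(z : 'I_n * 'I_d) (if tau < `|Y z.1 z.2| then `|Y z.1 z.2| else 0) <= b1 ->
  \sum_(z : 'I_n * 'I_d) (if `|Y z.1 z.2| <= tau then `|Y z.1 z.2| ^+ 2 else 0) <= b2 ->
  \sum_i l1norm (col i (M *m Y)) <=
    cs * b1 + Num.sqrt m%:R * (3 / 2 * Num.sqrt (d%:R * b2)).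
Proof.
move=> cs0 Mcs Memb hb1 hb2.
have colM i : l1norm (col i (M *m Y)) <= cs * l1norm (col i (heavy tau Y)) +
    Num.sqrt m%:R * (3 / 2 * l2norm (col i (light tau Y))).
  rewrite colE -mulmxA -colE {1}(light_heavy tau Y) linearD/= mulmxDr addrC.
  apply: le_trans (l1normD _ _) _; apply: lerD; first exact: l1norm_mulmx_le.
  apply: le_trans (l1norm_le_l2norm _) _; rewrite ler_wpM2l ?sqrtr_ge0//.
  by have /andP[] := Memb i.
apply: le_trans (ler_sum _ (fun i _ => colM i)) _.
rewrite big_split/= -!mulr_sumr lerD//.
  rewrite ler_wpM2l//; apply: le_trans hb1; rewrite /l1norm exchange_big/=.
  rewrite -(pair_bigA _ (fun k i => if tau < `|Y k i| then `|Y k i| else 0))/=.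
  rewrite le_eqVlt; apply/orP; left; apply/eqP; apply: eq_bigr => k _.
  by apply: eq_bigr => i _; rewrite !mxE; case: ifP => //; rewrite normr0.
rewrite ler_wpM2l ?sqrtr_ge0// ler_wpM2l//.
have s0 : 0 <= \sum_i l2norm (col i (light tau Y)).
  by apply: sumr_ge0 => i _; exact: l2norm_ge0.
rewrite -[leLHS](ger0_norm s0) -sqrtr_sqr; apply: ler_wsqrtr.
apply: le_trans (sqr_sum_le_card _) _; rewrite card_ord ler_wpM2l//.
apply: le_trans hb2.
rewrite -(pair_bigA _ (fun k i => if `|Y k i| <= tau then `|Y k i| ^+ 2 else 0))/=.
rewrite exchange_big/= le_eqVlt; apply/orP; left; apply/eqP; apply: eq_bigr => i _.
rewrite sqr_l2norm; apply: eq_bigr => k _; rewrite !mxE; case: ifP => _.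
  by rewrite real_normK ?num_real.
by rewrite expr0n.
Qed.

Definition grid_point (q : nat) (f : {ffun 'I_d -> 'I_(q.*2.+1)}) : 'cV[R]_d :=
  \col_j ((f j)%:R / q%:R - 1).

Lemma grid_dense (q : nat) (x : 'cV[R]_d) : (0 < q)%N -> (forall j, `|x j 0| <= 1) ->
  exists f : {ffun 'I_d -> 'I_(q.*2.+1)}, forall j, `|(x - grid_point f) j 0| <= q%:R^-1.
Proof.
move=> q0 x1; have q0' : 0 < q%:R :> R by rewrite ltr0n.
have h j : exists k : 'I_(q.*2.+1), `|x j 0 - (k%:R / q%:R - 1)| <= q%:R^-1.
  have := x1 j; rewrite ler_norml => /andP[xl xu].
  have y0 : 0 <= q%:R * (x j 0 + 1) by rewrite mulr_ge0//; lra.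
  have /andP[tl tu] := truncn_itv y0.
  (* Coordinates are rounded down; [q (x + 1)] lies in [[0, 2 q]], hence the [2 q + 1] grid
     values. *)
  have kq : (Num.truncn (q%:R * (x j 0 + 1))%R < q.*2.+1)%N.
    rewrite ltnS -(ler_nat R); apply: le_trans tl _.
    by rewrite -muln2 natrM ler_wpM2l//; lra.
  exists (Ordinal kq) => /=; move: tl tu; set k := Num.truncn _ => tl tu.
  have -> : x j 0 - (k%:R / q%:R - 1) = (q%:R * (x j 0 + 1) - k%:R) / q%:R.
    by field; rewrite gt_eqF.
  have qV : 0 <= q%:R^-1 :> R by rewrite invr_ge0 ltW.
  rewrite normrM (ger0_norm qV) ger0_norm ?subr_ge0//.
  rewrite -[leRHS]mul1r; apply: ler_wpM2r => //.
  by move: tu; rewrite -natr1; lra.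
have [f hf] := choice h.
by exists [ffun j => f j] => j; rewrite !mxE ffunE.
Qed.

(** Above, [|x_j| <= |A x|_1] suffices. Below, normalise to [|A y|_1 = 1] and take a grid point [g]
    near [y]: unit columns and [d / q <= 1 / 2] give [|A g|_1 >= 1 / 2], so the sketch of [g] has
    norm at least [rho / 4], and moving to [y] costs at most [U / q <= rho / 8]. *)
Lemma net_distortion (M : 'M[R]_(m, n)) (Y A : 'M[R]_(n, d)) (V : {vspace 'cV[R]_n})
  (rho U : R) (q : nat) :
  auerbach_basis V A -> (0 < q)%N -> 0 <= rho ->
  d%:R / q%:R <= 1 / 2 :> R -> U / q%:R <= rho / 8 ->
  \sum_i l1norm (col i (M *m Y)) <= U ->
  (forall f : {ffun 'I_d -> 'I_(q.*2.+1)}, embeds M (Y *m grid_point f) /\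
     rho * l1norm (A *m grid_point f) <= l2norm (Y *m grid_point f)) ->
  forall x, rho / 8 * l1norm (A *m x) <= l1norm (M *m Y *m x) <= U * l1norm (A *m x).
Proof.
move=> [_ A1 Ax] q0 rho0 dq Uq hU hf x.
have q0' : 0 < q%:R :> R by rewrite ltr0n.
have upper z : l1norm (M *m Y *m z) <= \sum_j `|z j 0| * l1norm (col j (M *m Y)).
  exact: l1norm_mulmx.
apply/andP; split; last first.
  apply: le_trans (upper x) _.
  apply: (@le_trans _ _ (\sum_j l1norm (A *m x) * l1norm (col j (M *m Y)))).
    by apply: ler_sum => j _; rewrite ler_wpM2r ?l1norm_ge0.
  by rewrite -mulr_sumr mulrC ler_wpM2r ?l1norm_ge0.
have [Ax0|Ax0] := eqVneq (l1norm (A *m x)) 0; first by rewrite Ax0 mulr0 l1norm_ge0.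
have Axp : 0 < l1norm (A *m x) by rewrite lt_neqAle eq_sym Ax0 l1norm_ge0.
pose y := (l1norm (A *m x))^-1 *: x.
have xy : x = l1norm (A *m x) *: y by rewrite scalerA divff// scale1r.
rewrite [in leRHS]xy -scalemxAr l1normZ ger0_norm ?l1norm_ge0// mulrC ler_wpM2l ?l1norm_ge0//.
have Ay : l1norm (A *m y) = 1.
  by rewrite -scalemxAr l1normZ ger0_norm ?invr_ge0 ?l1norm_ge0// mulVf.
have [f fy] : exists f : {ffun 'I_d -> 'I_(q.*2.+1)}, forall j, `|(y - grid_point f) j 0| <= q%:R^-1.
  by apply: grid_dense => // j; rewrite -Ay; exact: Ax.
have [/andP[emb _] lowf] := hf f.
set g := grid_point f in fy emb lowf.
have Ag : 1 / 2 <= l1norm (A *m g).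
  have : l1norm (A *m (y - g)) <= 1 / 2.
    apply: le_trans (l1norm_mulmx _ _) _; apply: le_trans dq.
    apply: (@le_trans _ _ (\sum_(j < d) q%:R^-1)); last by rewrite sumr_const card_ord mulr_natl.
    by apply: ler_sum => j _; rewrite A1 mulr1.
  have := l1normD (A *m (y - g)) (A *m g); rewrite -mulmxDr subrK Ay; lra.
have Mdiff : l1norm (M *m Y *m (g - y)) <= rho / 8.
  apply: le_trans (upper _) _; apply: le_trans Uq.
  apply: (@le_trans _ _ (\sum_j q%:R^-1 * l1norm (col j (M *m Y)))).
    apply: ler_sum => j _; rewrite ler_wpM2r ?l1norm_ge0//.
    by have := fy j; rewrite !mxE distrC.
  by rewrite -mulr_sumr mulrC; apply: ler_wpM2r => //; rewrite invr_ge0 ltW.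
have Mg : rho / 4 <= l1norm (M *m Y *m g).
  rewrite -mulmxA; apply: le_trans (l2norm_le_l1norm _); apply: le_trans emb.
  apply: (@le_trans _ _ (1 / 2 * (rho * l1norm (A *m g)))); last by rewrite ler_wpM2l.
  by nra.
have := l1normD (M *m Y *m (g - y)) (M *m Y *m y); rewrite -mulmxDr subrK; lra.
Qed.

End Deterministic.

(** * The sketch of a randomly scaled Auerbach basis *)

Section RowScaling.
Context (R : realType) (n d : nat) (A : 'M[R]_(n, d)).

Definition row_scaled (v : 'I_n -> R) : 'M[R]_(n, d) := \matrix_(k, i) (A k i / v k).

Lemma row_scaled_mul v (x : 'cV[R]_d) k : (row_scaled v *m x) k 0 = (A *m x) k 0 / v k.
Proof. by rewrite !mxE mulr_suml; apply: eq_bigr => i _; rewrite mxE mulrAC. Qed.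

Lemma normr_row_scaled v k i : `|row_scaled v k i| = `|A k i| / `|v k|.
Proof. by rewrite mxE normrM normfV. Qed.

(** Homogeneity: it transfers a bound for weights of sum [1], the form of [weighted_l2_lower_tail],
    to arbitrary [x]. *)
Lemma l2norm_row_scaled v (x : 'cV[R]_d) (c : R) : 0 <= c ->
  (l1norm (A *m x) != 0 ->
    c <= \sum_k (`|(A *m x) k 0| / l1norm (A *m x) / v k) ^+ 2) ->
  Num.sqrt c * l1norm (A *m x) <= l2norm (row_scaled v *m x).
Proof.
move=> c0 hc; have [->|l0] := eqVneq (l1norm (A *m x)) 0.
  by rewrite mulr0 l2norm_ge0.
rewrite -ler_sqr ?nnegrE ?mulr_ge0 ?sqrtr_ge0 ?l1norm_ge0 ?l2norm_ge0//.
rewrite exprMn sqr_sqrtr// sqr_l2norm.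
apply: le_trans (ler_wpM2r (sqr_ge0 _) (hc l0)) _; rewrite mulr_suml.
apply: ler_sum => k _; rewrite row_scaled_mul !exprMn real_normK ?num_real//.
by move: (v k)^-1 => vi; rewrite le_eqVlt; apply/orP; left; apply/eqP; field.
Qed.

Lemma measurable_row_scaled (disp : measure_display) (T : measurableType disp)
  (v : 'I_n -> T -> R) : (forall k, measurable_fun setT (v k)) ->
  forall k i, measurable_fun setT (fun w => row_scaled (v ^~ w) k i).
Proof.
move=> mv k i; under eq_fun do rewrite mxE.
by apply: measurable_funM => //; exact: measurable_fun_inv.
Qed.

Lemma measurable_light (disp : measure_display) (T : measurableType disp)
  (v : 'I_n -> T -> R) (tau : R) : (forall k, measurable_fun setT (v k)) ->
  forall k i, measurable_fun setT (fun w => light tau (row_scaled (v ^~ w)) k i).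
Proof.
move=> mv k i; under eq_fun do rewrite mxE.
have mY := measurable_row_scaled mv k i.
apply: measurable_fun_ifT => //; apply: measurable_fun_ler => //.
exact: measurableT_comp.
Qed.

End RowScaling.

Lemma inverse_diag_mul (disp : measure_display) (T : measurableType disp) (R : realType)
  (P : probability T R) (n d : nat) (A : 'M[R]_(n, d)) (u : 'I_n -> {RV P >-> R}) w :
  inverse_diag u w *m A = row_scaled A (fun k => u k w).
Proof. by apply/matrixP => k i; rewrite mul_diag_mx !mxE mulrC. Qed.

(** * Union of all bad events *)

Section Main.
Context (R : realType) (n d m s : nat) (V : {vspace 'cV[R]_n}) (A : 'M[R]_(n, d))
  (disp : measure_display) (T : measurableType disp) (P : probability T R)
  (u : 'I_n -> {RV P >-> R}) (S : T -> 'M[R]_(\sum_(j < s) (m %/ s), n)).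
Hypotheses (s_dvd_m : (s %| m)%N) (dimV : \dim V = d) (aA : auerbach_basis V A)
  (iidu : iid_standard_exponential u) (formS : sparse_sign_form P S)
  (oseS : oblivious_subspace_embedding P d S) (indepS : discrete_independent S u).

Let Y w := row_scaled A (fun k => u k w).

Lemma sum_auerbach : \sum_(z : 'I_n * 'I_d) `|A z.1 z.2| = d%:R.
Proof.
have [_ A1 _] := aA.
rewrite -(pair_bigA _ (fun k i => `|A k i|))/= exchange_big/=.
rewrite (eq_bigr (fun=> 1)); first by rewrite sumr_const card_ord.
by move=> i _; rewrite -[RHS](A1 i); apply: eq_bigr => k _; rewrite mxE.
Qed.

Lemma measurable_u k : measurable_fun setT (u k).
Proof. exact: measurable_funPT. Qed.

Lemma exponential_all_pos :
  measurable [set w | exists k, u k w <= 0] /\ prob P [set w | exists k, u k w <= 0] <= 0.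
Proof.
have [_ expu] := iidu.
have mk k : measurable [set w | u k w <= 0] by apply: measurable_fun_le_set => //; exact: measurable_u.
have mE : measurable [set w | exists k, u k w <= 0].
  exact: (@measurable_finite_union _ _ 'I_n (fun k => [set w | u k w <= 0])).
split => //; apply: le_trans (@prob_union_bound _ _ _ P 'I_n (fun k => [set w | u k w <= 0]) _ mk mE _) _ => //.
rewrite big1// => k _; rewrite (exponential_cdf (expu k))//.
by rewrite oppr0 expR0 subrr.
Qed.

Lemma exponential_max_tail (l : R) : 0 <= l ->
  measurable [set w | exists k, l < u k w] /\
  prob P [set w | exists k, l < u k w] <= n%:R * expR (- l).
Proof.
move=> l0; have [_ expu] := iidu.
have mk k : measurable [set w | l < u k w] by apply: measurable_fun_lt_set => //; exact: measurable_u.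
have mE : measurable [set w | exists k, l < u k w].
  exact: (@measurable_finite_union _ _ 'I_n (fun k => [set w | l < u k w])).
split => //; apply: le_trans (@prob_union_bound _ _ _ P 'I_n (fun k => [set w | l < u k w]) _ mk mE _) _ => //.
under eq_bigr do rewrite (exponential_tail (expu _))//.
by rewrite sumr_const card_ord mulr_natl.
Qed.

Lemma measurable_sketch_distortion (a b : R) : 0 <= a -> 0 <= b ->
  measurable [set w | forall x : 'cV[R]_d, a * l1norm (A *m x) <=
      l1norm (S w *m inverse_diag u w *m A *m x) <= b * l1norm (A *m x)].
Proof.
move=> a0 b0; have [I [Mv [Mv_inj S_Mv mS]]] := sparse_finite_valued formS.
have mSe := measurable_entry Mv_inj S_Mv mS.
apply: measurable_distortion => // i k.
under eq_fun do rewrite -mulmxA inverse_diag_mul.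
exact: (measurable_mulmx mSe (measurable_row_scaled A measurable_u)).
Qed.

(** Outside seven bad events the deterministic bounds apply: heavy mass (2/100), light mass,
    embedding of light columns, embedding of grid images, a nonpositive [u_k] (null), a [u_k] above
    [l], and failure of the lower tail at a grid point (1/100 each). The total is 7/100. *)
Lemma sketch_distortion (J J' q : nat) (tau b1 b2 t l : R) :
  let L := Num.min t l in
  let rho := Num.sqrt ((12 * t * L)^-1) in
  let U := Num.sqrt s%:R * b1 + Num.sqrt m%:R * (3 / 2 * Num.sqrt (d%:R * b2)) in
  0 < tau -> 0 < b1 -> 0 < b2 -> 0 < t -> 1 <= L -> (0 < q)%N ->
  d%:R / q%:R <= 1 / 2 :> R -> U / q%:R <= rho / 8 ->
  d%:R / (2 ^+ J * tau) + 2 * J%:R * d%:R / b1 <= 2 / 100 ->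
  ((n * d)%:R * ((2^-1) ^+ J' * tau) ^+ 2 + 4 * tau * d%:R) / b2 <= 1 / 100 ->
  n%:R * expR (- l) <= 1 / 100 ->
  (q.*2.+1 ^ d)%:R * expR (- (t / 12)) <= 1 / 100 ->
  2 / 3 <= prob P [set w | forall x : 'cV[R]_d, rho / 8 * l1norm (A *m x) <=
      l1norm (S w *m inverse_diag u w *m A *m x) <= U * l1norm (A *m x)].
Proof.
move=> L rho U tau0 b10 b20 t0 L1 q0 dq Uq ph pl pu pn.
have [_ expu] := iidu.
have [I [Mv [Mv_inj S_Mv mS]]] := sparse_finite_valued formS.
have rho0 : 0 <= rho by exact: sqrtr_ge0.
have U0 : 0 <= U.
  by rewrite addr_ge0// !mulr_ge0 ?sqrtr_ge0// ltW.
have SYE w : S w *m inverse_diag u w *m A = S w *m Y w.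
  by rewrite -mulmxA inverse_diag_mul.
set G := [set w | _].
have mG : measurable G.
  by apply: measurable_sketch_distortion => //; rewrite divr_ge0.
pose a (z : 'I_n * 'I_d) : R := `|A z.1 z.2|.
pose Uz (z : 'I_n * 'I_d) : T -> R := u z.1.
have a0 z : 0 <= a z by exact: normr_ge0.
have mUz z : measurable_fun setT (Uz z) by exact: measurable_u.
have smallU z y : 0 <= y -> prob P [set w | `|Uz z w| <= y] <= y.
  by move=> y0; exact: exponential_small_ball.
have mratio z : measurable_fun setT (fun w => a z / `|Uz z w|).
  by apply: measurable_funM => //; apply: measurable_fun_inv; exact: measurableT_comp.
pose Eh := [set w | b1 < \sum_z (if tau < a z / `|Uz z w| then a z / `|Uz z w| else 0)].
have mEh : measurable Eh.
  apply: measurable_fun_lt_set => //; apply: measurable_sum => z.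
  by apply: measurable_fun_ifT => //; exact: measurable_fun_ltr.
pose El := [set w | b2 < \sum_z (if a z / `|Uz z w| <= tau then (a z / `|Uz z w|) ^+ 2 else 0)].
have mEl : measurable El.
  apply: measurable_fun_lt_set => //; apply: measurable_sum => z.
  apply: measurable_fun_ifT => //; first exact: measurable_fun_ler.
  exact: measurable_funX.
have pEh : prob P Eh <= 2 / 100.
  by apply: le_trans (heavy_part_tail a0 mUz smallU J tau0 b10 mEh) _; rewrite sum_auerbach.
have pEl : prob P El <= 1 / 100.
  apply: le_trans (light_part_tail a0 mUz smallU J' tau0 b20 mEl) _.
  by rewrite sum_auerbach card_prod !card_ord.
(* Both uses of the embedding need measurability in the sigma-algebra of [u]. The first family is
   the [d] columns of the light part; the second, the images of all grid points, lies in the span of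
   the [d] columns of [Y w]. *)
have mub := @measurable_boxes_fun _ _ _ P n u.
have [mE1 pE1] := @ose_random_family _ _ _ P _ _ _ d S u I Mv Mv_inj S_Mv mS indepS oseS 'I_d
  (fun i w => col i (light tau (Y w)))
  (fun i k => ltac:(under eq_fun do rewrite mxE; exact: (measurable_light A tau mub)))
  (fun w => sub_dim_family _ dimV).
have [mE2 pE2] := @ose_random_family _ _ _ P _ _ _ d S u I Mv Mv_inj S_Mv mS indepS oseS
  {ffun 'I_d -> 'I_(q.*2.+1)} (fun f w => Y w *m grid_point R f)
  (fun f k => ltac:(apply: (measurable_mulmx (measurable_row_scaled A mub)); by []))
  (fun w => ltac:(have [W dW hW] := sub_dim_family (fun i => col i (Y w)) dimV;
     exists W => // f; rewrite mulmx_col_sum; apply: memv_suml => i _; exact: memvZ)).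
have [mE3 pE3] := exponential_all_pos.
have l0 : 0 <= l.
  by move: L1; rewrite le_min => /andP[_]; apply: le_trans.
have [mE4 pE4] := exponential_max_tail l0.
pose ak (f : {ffun 'I_d -> 'I_(q.*2.+1)}) k : R := `|(A *m grid_point R f) k 0| / l1norm (A *m grid_point R f).
(* If [A] sends the grid point to [0], the weights cannot be normalised, but the desired bound is
   trivial; the event is then empty. *)
pose Ef (f : {ffun 'I_d -> 'I_(q.*2.+1)}) : set T :=
  if l1norm (A *m grid_point R f) == 0 then set0 else
  [set w | forall k, 0 < u k w /\ (u k w <= L \/ t <= L)] `&`
  [set w | \sum_k (ak f k / u k w) ^+ 2 < (12 * t * L)^-1].
have mEf f : measurable (Ef f).
  rewrite /Ef; case: ifP => _; first exact: measurable0.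
  apply: measurableI.
    apply: (@measurable_finite_inter _ _ 'I_n (fun k =>
      [set w | 0 < u k w] `&` ([set w | u k w <= L] `|` [set w | t <= L]))) => //.
    move=> k; apply: measurableI; first by apply: measurable_fun_lt_set => //; exact: measurable_u.
    apply: measurableU; first by apply: measurable_fun_le_set => //; exact: measurable_u.
    exact: measurable_fun_le_set.
  apply: measurable_fun_lt_set => //; apply: measurable_sum => k; apply: measurable_funX.
  by apply: measurable_funM => //; apply: measurable_fun_inv; exact: measurable_u.
have pEf f : prob P (Ef f) <= expR (- (t / 12)).
  have := mEf f; rewrite /Ef; case: ifPn => [_ _|l1f mf].
    by rewrite /prob measure0 expR_ge0.
  have l1p : 0 < l1norm (A *m grid_point R f) by rewrite lt_neqAle eq_sym l1f l1norm_ge0.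
  apply: (weighted_l2_lower_tail iidu _ _ L1 t0 mf (a := ak f)) => //.
    by move=> k; rewrite divr_ge0// l1norm_ge0.
  by rewrite -mulr_suml divff.
pose E5 := [set w | exists f, Ef f w].
have mE5 : measurable E5 by exact: (@measurable_finite_union _ _ _ Ef).
have pE5 : prob P E5 <= 1 / 100.
  apply: le_trans (@prob_union_bound _ _ _ P _ Ef _ mEf mE5 _) _ => //.
  apply: le_trans (ler_sum _ (fun f _ => pEf f)) _.
  by rewrite sumr_const card_ffun !card_ord -[leLHS]mulr_natl.
set E1 := [set w | _] in mE1 pE1; set E2 := [set w | _] in mE2 pE2.
set E3 := [set w | _] in mE3 pE3; set E4 := [set w | _] in mE4 pE4.
have sub : ~` G `<=` Eh `|` (El `|` (E1 `|` (E2 `|` (E3 `|` (E4 `|` E5))))).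
  move=> w nG; apply: contrapT => nE; apply: nG.
  have nEh : ~ Eh w by move=> h; apply: nE; left.
  have nEl : ~ El w by move=> h; apply: nE; right; left.
  have nE1 : ~ E1 w by move=> h; apply: nE; do 2 right; left.
  have nE2 : ~ E2 w by move=> h; apply: nE; do 3 right; left.
  have nE3 : ~ E3 w by move=> h; apply: nE; do 4 right; left.
  have nE4 : ~ E4 w by move=> h; apply: nE; do 5 right; left.
  have nE5 : ~ E5 w by move=> h; apply: nE; do 6 right.
  have ratioE z : a z / `|Uz z w| = `|Y w z.1 z.2| by rewrite normr_row_scaled.
  move=> x; rewrite SYE; apply: (net_distortion aA q0 rho0 dq Uq).
    rewrite /U (_ : m%:R = (\sum_(j < s) (m %/ s))%N%:R); last first.
      by rewrite sum_nat_const card_ord mulnC divnK.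
    apply: (@sketch_upper_bound _ _ _ _ _ _ tau).
    - exact: sqrtr_ge0.
    - by move=> k; rewrite (sparse_column_l1norm formS).
    - by move=> i; apply: contrapT => /negP h; apply: nE1; exists i.
    - rewrite leNgt; apply/negP => h; apply: nEh; rewrite /Eh/=.
      by under eq_bigr do rewrite ratioE.
    - rewrite leNgt; apply/negP => h; apply: nEl; rewrite /El/=.
      by under eq_bigr do rewrite ratioE.
  move=> f; split.
    by apply: contrapT => /negP h; apply: nE2; exists f.
  apply: l2norm_row_scaled; last move=> l1f.
    by rewrite invr_ge0 !mulr_ge0// ltW//; apply: lt_le_trans L1.
  rewrite leNgt; apply/negP => h; apply: nE5; exists f; rewrite /Ef (negPf l1f); split => //= k.
  split; first by rewrite ltNge; apply/negP => h'; apply: nE3; exists k.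
  have ul : u k w <= l by rewrite leNgt; apply/negP => h'; apply: nE4; exists k.
  (* Either [L = t], or [L = l] and the bound on the maximum applies. *)
  by rewrite /L; case: (leP t l) => tl; [right|left].
have mall : measurable (Eh `|` (El `|` (E1 `|` (E2 `|` (E3 `|` (E4 `|` E5)))))).
  by do ?apply: measurableU.
have := prob_le P (measurableC mG) mall sub.
rewrite prob_setC//.
have := @prob_setU _ _ _ P _ _ mEh (measurableU _ _ mEl (measurableU _ _ mE1 (measurableU _ _ mE2 (measurableU _ _ mE3 (measurableU _ _ mE4 mE5))))).
have := @prob_setU _ _ _ P _ _ mEl (measurableU _ _ mE1 (measurableU _ _ mE2 (measurableU _ _ mE3 (measurableU _ _ mE4 mE5)))).
have := @prob_setU _ _ _ P _ _ mE1 (measurableU _ _ mE2 (measurableU _ _ mE3 (measurableU _ _ mE4 mE5))).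
have := @prob_setU _ _ _ P _ _ mE2 (measurableU _ _ mE3 (measurableU _ _ mE4 mE5)).
have := @prob_setU _ _ _ P _ _ mE3 (measurableU _ _ mE4 mE5).
have := @prob_setU _ _ _ P _ _ mE4 mE5.
lra.
Qed.

End Main.

(** * Choice of parameters *)

Section Numerics.
Context (R : realType).

Lemma natr_pow2_bound (C : R) : exists p : nat, C <= 2 ^+ p.
Proof.
exists (Num.truncn C).+1; apply: le_trans (ltW (truncnS_gt C)) _.
by rewrite -natrX ler_nat ltnW// ltn_expl.
Qed.

Lemma ln2_ge_half : 1 / 2 <= ln (2 : R).
Proof.
rewrite -ler_expR lnK ?posrE//.
have h := expR_ge1Dx (- (1 / 2) : R).
have : expR (- (1 / 2)) * expR (1 / 2) = 1 :> R by rewrite -expRD addNr expR0.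
have := expR_gt0 (1 / 2 : R); nra.
Qed.

Lemma ln_ge_half (n : nat) : (1 < n)%N -> 1 / 2 <= ln (n%:R : R).
Proof.
move=> n1; apply: le_trans ln2_ge_half _; rewrite ler_ln ?posrE ?ltr0n ?ler_nat//.
exact: ltnW.
Qed.

Lemma ln_le_nat (n : nat) : (0 < n)%N -> ln (n%:R : R) <= n%:R.
Proof.
by move=> n0; rewrite ltW// ln_sublinear// ltr0n.
Qed.

Lemma expRN_le_inv (x : R) : 99 <= x -> expR (- x) <= 1 / 100.
Proof.
move=> x99; rewrite expRN div1r lef_pV2 ?posrE ?expR_gt0//.
by apply: le_trans (expR_ge1Dx x); lra.
Qed.

(** The binary logarithm rounded down is at most [2 ln d] because [ln 2 >= 1 / 2], and the added [1]
    is at most [2 ln d] too. *)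
Lemma dyadic_exponent (d : nat) : (1 < d)%N ->
  exists e : nat, [/\ (d <= 2 ^ e)%N, (0 < e)%N & e%:R <= 4 * ln (d%:R : R)].
Proof.
move=> d1; exists (trunc_log 2 d).+1; split => //.
  by rewrite ltnW// trunc_log_ltn.
have x2 := ln_ge_half d1.
have : (trunc_log 2 d)%:R * ln (2 : R) <= ln (d%:R : R).
  rewrite mulr_natl -lnXn//; rewrite ler_ln ?posrE ?exprn_gt0 ?ltr0n//; last exact: ltnW.
  by rewrite -natrX ler_nat trunc_logP// ltnW.
have T0 : 0 <= (trunc_log 2 d)%:R :> R by [].
have Th := ler_wpM2l T0 ln2_ge_half.
by rewrite -[_.+1%:R]natr1; lra.
Qed.

(** Resolves a circular choice: [K] must exceed a multiple of the exponent [2 z + 20] of the grid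
    size, while the grid must be fine compared with [K]. The power [K = 2^(z + 12)] meets both;
    [121 = 22 + 99] is set by [net_budget]. *)
Lemma linear_le_pow2 (z : nat) : 12 * (2 * z%:R + 121) <= 2 ^+ (z + 12) :> R.
Proof.
elim: z => [|z IH]; first by rewrite add0n -natrX; have := @ler_nat R 1452 (2 ^ 12); rewrite /=; lra.
rewrite addSn exprS -[z.+1%:R]natr1.
have : (1 : R) <= 2 ^+ (z + 12) by rewrite exprn_ege1// ler1n.
have : 0 <= z%:R :> R by [].
lra.
Qed.

(** The minimum in [L = min (t, l)] becomes the maximum of the two rates in the theorem. *)
Lemma max_inv_le_inv_sqrt (z y : R) : 0 < z -> 0 < y ->
  Num.max z^-1 (Num.sqrt (z * y))^-1 <= (Num.sqrt (z * Num.min z y))^-1.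
Proof.
move=> z0 y0; have m0 : 0 < Num.min z y by rewrite lt_min z0.
rewrite ge_max; apply/andP; split; rewrite lef_pV2 ?posrE ?sqrtr_gt0 ?mulr_gt0//.
  rewrite -[leRHS](ger0_norm (ltW z0)) -sqrtr_sqr; apply: ler_wsqrtr.
  by rewrite expr2 ler_pM2l// ge_min lexx.
by apply: ler_wsqrtr; rewrite ler_pM2l// ge_min lexx orbT.
Qed.

(** Both parts use [12 <= 4^2]. The first gives the final rate; the second, through [L <= t], is the
    cruder form used for the mesh. *)
Lemma sqrt_inv_lower (K z y : R) : 0 < K -> 0 < z -> 0 < y ->
  let t := K * z in let L := Num.min t (K * y) in
  (4 * K)^-1 * (Num.sqrt (z * Num.min z y))^-1 <= Num.sqrt ((12 * t * L)^-1) /\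
  (4 * t)^-1 <= Num.sqrt ((12 * t * L)^-1).
Proof.
move=> K0 z0 y0 t L.
have m0 : 0 < Num.min z y by rewrite lt_min z0.
have LE : L = K * Num.min z y by rewrite /L /t minr_pMr// ltW.
have t0 : 0 < t by rewrite mulr_gt0.
have L0 : 0 < L by rewrite LE mulr_gt0.
have a0 : 0 <= 12 * t * L by rewrite !mulr_ge0// ltW.
have K4 : 0 <= 4 * K by rewrite mulr_ge0// ltW.
have t4 : 0 <= 4 * t by rewrite mulr_ge0// ltW.
rewrite sqrtrV//; split.
  rewrite -invfM lef_pV2 ?posrE ?sqrtr_gt0 ?mulr_gt0 ?sqrtr_gt0 ?mulr_gt0//.
  rewrite -(ger0_norm K4) -sqrtr_sqr -sqrtrM ?sqr_ge0//.
  apply: ler_wsqrtr; rewrite LE /t.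
  have : 0 <= K * K * (z * Num.min z y) by rewrite !mulr_ge0 ?ltW.
  by rewrite expr2; nra.
rewrite lef_pV2 ?posrE ?sqrtr_gt0 ?mulr_gt0//.
rewrite -(ger0_norm t4) -sqrtr_sqr; apply: ler_wsqrtr.
have Lt : L <= t by rewrite /L ge_min lexx.
by rewrite expr2; nra.
Qed.

Lemma natr_le_pow2 (p d : nat) : (1 < d)%N -> (2 : R) ^+ p <= d%:R ^+ p.
Proof. by move=> d1; rewrite lerXn2r ?nnegrE// ler_nat. Qed.

(** Since [2 <= d] and [ln d <= d], constants and logarithms are absorbed into powers of [d]. *)
Lemma dimension_le_pow (Cm : R) (p km m d : nat) : (1 < d)%N -> Cm <= 2 ^+ p ->
  m%:R <= Cm * d%:R * ln (d%:R : R) ^+ km -> m%:R <= d%:R ^+ (p + km.+1) :> R.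
Proof.
move=> d1 Cp hm; apply: le_trans hm _.
have x0 : 0 <= ln (d%:R : R) by have := ln_ge_half d1; lra.
have xd : ln (d%:R : R) ^+ km <= d%:R ^+ km.
  by rewrite lerXn2r ?nnegrE// ln_le_nat// ltnW.
rewrite exprD exprS -mulrA.
apply: (@le_trans _ _ (2 ^+ p * (d%:R * ln d%:R ^+ km))).
  by rewrite ler_wpM2r// mulr_ge0// exprn_ge0.
by apply: ler_pM; rewrite ?mulr_ge0 ?exprn_ge0// ?natr_le_pow2// ler_wpM2l.
Qed.

End Numerics.

(** The heavy part uses [sqrt s <= s] and [e <= 4 ln d], whence [1600 = 400 * 4]. The light part is
    at most [35 d] because [m tau <= 1], [sqrt 500 <= 23] and [23 * 3 / 2 <= 35]; then [2 ln d >= 1]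
    restores the power of the logarithm. *)
Lemma upper_constant (R : realType) (Cs tau : R) (ks a e d m s : nat) :
  (1 < d)%N -> (0 < s)%N -> s%:R <= Cs * ln (d%:R : R) ^+ ks ->
  e%:R <= 4 * ln (d%:R : R) -> 0 < tau -> m%:R * tau <= 1 ->
  Num.sqrt s%:R * (400 * d%:R * (e * (a + 8))%:R) +
    Num.sqrt m%:R * (3 / 2 * Num.sqrt (d%:R * (500 * d%:R * tau))) <=
  (1600 * (a + 8)%:R * `|Cs| + 35 * 2 ^+ ks.+1) * d%:R * ln (d%:R : R) ^+ ks.+1.
Proof.
move=> d1 s0 hs he tau0 mtau.
have x2 := ln_ge_half R d1; set x := ln _ in hs he x2 *.
have x0 : 0 <= x by lra.
have xk j : 0 <= x ^+ j by exact: exprn_ge0.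
have s1 : 1 <= s%:R :> R by rewrite ler1n.
have sqs : Num.sqrt (s%:R : R) <= `|Cs| * x ^+ ks.
  apply: (@le_trans _ _ s%:R).
    rewrite -[leRHS](@ger0_norm R)// -sqrtr_sqr; apply: ler_wsqrtr.
    by rewrite expr2 -[leLHS]mulr1 ler_wpM2l.
  by apply: le_trans hs _; rewrite ler_wpM2r// ler_norm.
have -> : (1600 * (a + 8)%:R * `|Cs| + 35 * 2 ^+ ks.+1) * d%:R * x ^+ ks.+1 =
    `|Cs| * x ^+ ks * (400 * d%:R * (4 * x * (a + 8)%:R)) +
    35 * d%:R * (2 * x) ^+ ks.+1 by rewrite exprMn [x ^+ ks.+1]exprS; ring.
have heavyE (c : R) : 0 <= c -> Num.sqrt s%:R * (c * d%:R * (e * (a + 8))%:R) <=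
    `|Cs| * x ^+ ks * (c * d%:R * (4 * x * (a + 8)%:R)).
  move=> c0; apply: ler_pM; rewrite ?sqrtr_ge0 ?mulr_ge0//.
  by rewrite ler_wpM2l ?mulr_ge0// natrM ler_wpM2r.
apply: lerD; first exact: heavyE (ler0n _ _).
apply: (@le_trans _ _ (35 * d%:R)); last first.
  rewrite -[leLHS]mulr1 ler_wpM2l ?mulr_ge0//.
  by apply: exprn_ege1; lra.
rewrite mulrCA -sqrtrM//.
have : Num.sqrt (m%:R * (d%:R * (500 * d%:R * tau))) <= 23 * d%:R.
  have d23 : 0 <= 23 * d%:R :> R by rewrite mulr_ge0.
  rewrite -[leRHS](ger0_norm d23) -sqrtr_sqr; apply: ler_wsqrtr.
  have -> : m%:R * (d%:R * (500 * d%:R * tau)) = 500 * d%:R ^+ 2 * (m%:R * tau) :> R by ring.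
  have := ler_wpM2l (mulr_ge0 (ler0n R 500) (sqr_ge0 (d%:R : R))) mtau.
  have := sqr_ge0 (d%:R : R); rewrite exprMn; lra.
have : 0 <= d%:R :> R by [].
lra.
Qed.

(** * Verification of the probability and mesh budgets *)

Section Budgets.
Context (R : realType).

Lemma one_le_mul_half (K y : R) : 2 <= K -> 1 / 2 <= y -> 1 <= K * y.
Proof. by move=> K2 y2; nra. Qed.

Lemma one_le_mul_ln (d : nat) : (1 < d)%N -> 1 <= d%:R * ln (d%:R : R).
Proof. by move=> d1; apply: one_le_mul_half (ln_ge_half _ d1); rewrite ler_nat. Qed.

Lemma grid_mesh (d g : nat) : (1 < d)%N -> (1 < g)%N ->
  d%:R / (d ^ g)%:R <= 1 / 2 :> R.
Proof.
move=> d1; case: g => // -[//|g] _; have d0 : 0 < d%:R :> R by rewrite ltr0n ltnW.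
rewrite ler_pdivrMr ?ltr0n ?expn_gt0 ?(ltnW d1)// mul1r mulrC ler_pdivlMr//.
rewrite -natrM ler_nat expnS leq_mul2l; apply/orP; right.
by rewrite expnS -[2%N]muln1 leq_mul// expn_gt0 ltnW.
Qed.

(** The choice of [J] gives [2^J >= d^(a + 8)], so the first term is at most [d^-7 <= 1 / 128]; the
    second is exactly [1 / 200]. *)
Lemma heavy_budget (d e a J : nat) : (1 < d)%N -> (0 < e)%N -> (d <= 2 ^ e)%N ->
  J = (e * (a + 8))%N ->
  d%:R / (2 ^+ J * (d%:R ^+ a)^-1) + 2 * J%:R * d%:R / (400 * d%:R * J%:R) <= 2 / 100 :> R.
Proof.
move=> d1 e0 de JE; have d0 : 0 < d%:R :> R by rewrite ltr0n ltnW.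
have J0 : 0 < J%:R :> R by rewrite JE ltr0n muln_gt0 e0 addn_gt0 orbT.
have -> : 2 * J%:R * d%:R / (400 * d%:R * J%:R) = 1 / 200 :> R.
  by field; rewrite !gt_eqF.
have da : 0 < d%:R ^+ a :> R by rewrite exprn_gt0.
have : d%:R / (2 ^+ J * (d%:R ^+ a)^-1) <= 1 / 128 :> R.
  rewrite ler_pdivrMr; last by rewrite mulr_gt0 ?invr_gt0// exprn_gt0.
  rewrite mulrA ler_pdivlMr//.
  have : d%:R ^+ a * d%:R ^+ 8 <= 2 ^+ J :> R.
    rewrite -exprD JE exprM; apply: lerXn2r; rewrite ?nnegrE ?exprn_ge0//.
    by rewrite -natrX ler_nat.
  have : 2 ^+ 7 <= d%:R ^+ 7 :> R by exact: natr_le_pow2.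
  rewrite [d%:R ^+ 8]exprS; have -> : 2 ^+ 7 = 128 :> R by rewrite !exprS expr0; ring.
  move: (d%:R ^+ 7) (d%:R ^+ a) (2 ^+ J) da => D7 Da TJ da h7 hJ.
  have : 128 * (Da * d%:R) <= D7 * (Da * d%:R).
    by apply: ler_wpM2r => //; rewrite mulr_ge0// ltW.
  lra.
lra.
Qed.

(** Taking as many layers as rows makes the remainder at most [d tau], by [n 2^-n <= 1]; then
    [5 d tau] is divided by [500 d tau]. *)
Lemma light_budget (n d : nat) (tau : R) : (0 < d)%N -> 0 < tau -> tau <= 1 ->
  ((n * d)%:R * ((2^-1) ^+ n * tau) ^+ 2 + 4 * tau * d%:R) / (500 * d%:R * tau) <= 1 / 100.
Proof.
move=> d1 tau0 tau1; have d0 : 0 < d%:R :> R by rewrite ltr0n.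
have dt : 0 < d%:R * tau by rewrite mulr_gt0.
rewrite ler_pdivrMr; last by rewrite -mulrA mulr_gt0 ?ltr0n.
have : (n * d)%:R * (2^-1 ^+ n * tau) ^+ 2 <= d%:R * tau.
  rewrite natrM exprMn expr2.
  have hn : n%:R * 2^-1 ^+ n <= 1 :> R.
    rewrite exprVn ler_pdivrMr ?exprn_gt0// mul1r -natrX ler_nat.
    exact/ltnW/ltn_expl.
  have h0 : 0 <= 2^-1 ^+ n :> R by exact: exprn_ge0.
  have h1 : 2^-1 ^+ n <= 1 :> R by rewrite exprn_ile1// invf_le1// ler1n.
  have n0 : 0 <= n%:R :> R by [].
  have -> : n%:R * d%:R * (2^-1 ^+ n * 2^-1 ^+ n * tau ^+ 2) =
    (d%:R * tau) * ((n%:R * 2^-1 ^+ n) * (2^-1 ^+ n * tau)) by ring.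
  rewrite -[leRHS]mulr1; apply: ler_wpM2l; first exact: ltW.
  exact: mulr_ile1 (mulr_ge0 n0 h0) (mulr_ge0 h0 (ltW tau0)) hn (mulr_ile1 h0 (ltW tau0) h1 tau1).
lra.
Qed.

Lemma maximum_budget (n : nat) (K : R) : (1 < n)%N -> 199 <= K ->
  n%:R * expR (- (K * ln n%:R)) <= 1 / 100.
Proof.
move=> n1 K199; have y2 := ln_ge_half R n1.
have -> : n%:R = expR (ln (n%:R : R)) by rewrite lnK// posrE ltr0n ltnW.
rewrite expRK -expRD; set y := ln _ in y2 *.
rewrite (_ : y + - (K * y) = - ((K - 1) * y)); last by ring.
by apply: expRN_le_inv; nra.
Qed.

(** With [q = d^(2 z + 20)], the grid side is [2 q + 1 <= 4 q <= d^(2 z + 22)]. The hypothesis on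
    [K] leaves a factor at least [99] of [d ln d >= 1] in the negative exponent. *)
Lemma net_budget (d z : nat) (K : R) : (1 < d)%N -> 12 * (2 * z%:R + 121) <= K ->
  (((d ^ (2 * z + 20)).*2.+1) ^ d)%:R * expR (- (K * (d%:R * ln d%:R) / 12)) <= 1 / 100.
Proof.
move=> d1 hK; have dx1 := one_le_mul_ln d1.
have qd : (((d ^ (2 * z + 20)).*2.+1) ^ d)%:R <= expR ((2 * z%:R + 22) * (d%:R * ln d%:R)) :> R.
  have -> : (2 * z%:R + 22) * (d%:R * ln d%:R) = ((2 * z + 22) * d)%:R * ln d%:R :> R.
    by rewrite natrM natrD natrM mulrA.
  rewrite expRM_natl lnK ?posrE ?ltr0n ?(ltnW d1)//.
  rewrite -natrX ler_nat expnM leq_exp2r; last exact: ltnW.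
  rewrite (_ : 2 * z + 22 = (2 * z + 20) + 2)%N; last by rewrite -addnA.
  rewrite [(d ^ (_ + 2))%N]expnD.
  have q0 : (0 < d ^ (2 * z + 20))%N by rewrite expn_gt0 ltnW.
  move: (d ^ (2 * z + 20))%N q0 => q q0.
  have d4 : (4 <= d ^ 2)%N by rewrite (leq_exp2r 2 d (isT : 0 < 2)%N).
  apply: (@leq_trans (q * 4)%N); last by rewrite leq_mul2l d4 orbT.
  by rewrite -muln2; lia.
apply: le_trans (ler_wpM2r (expR_ge0 _) qd) _; move: (d%:R * ln d%:R) dx1 => dx dx1.
rewrite -expRD (_ : _ + _ = - ((K / 12 - (2 * z%:R + 22)) * dx)); last by field.
apply: expRN_le_inv; have : 99 <= K / 12 - (2 * z%:R + 22) by lra.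
by move: (K / 12 - _) => v v99; nra.
Qed.

Lemma mesh_budget (d p k : nat) (U C K : R) : (1 < d)%N -> 0 <= C -> C <= 2 ^+ p ->
  K = 2 ^+ (p + k + 12) -> U <= C * d%:R * ln (d%:R : R) ^+ k ->
  U / (d ^ (2 * (p + k) + 20))%:R <= (4 * (K * (d%:R * ln d%:R)))^-1 / 8.
Proof.
move=> d1 C0 Cp KE hU; have x2 := ln_ge_half R d1.
have xd : ln (d%:R : R) <= d%:R by exact/ln_le_nat/ltnW.
have dx1 := one_le_mul_ln d1.
have K0 : 0 < K by rewrite KE exprn_gt0.
have d0 : 0 < d%:R :> R by rewrite ltr0n ltnW.
move: (ln _) hU x2 xd dx1 => x hU x2 xd dx1.
have x0 : 0 < x by lra.
have t0 : 0 < 4 * (K * (d%:R * x)) * 8 by rewrite !mulr_gt0.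
rewrite -invfM ler_pdivrMr ?ltr0n ?expn_gt0 ?(ltnW d1)// mulrC ler_pdivlMr//.
apply: le_trans (ler_wpM2r (ltW t0) hU) _.
have -> : C * d%:R * x ^+ k * (4 * (K * (d%:R * x)) * 8) =
  C * (2 ^+ 5 * (K * (d%:R * (d%:R * (x * x ^+ k))))) by ring.
(* Powers of [d] by factor: [C] takes [p], the [32] takes [5], [K] takes [p + k + 12], the two
   factors [d] and one logarithm take [3], and the other logarithms take [k]. *)
rewrite (_ : 2 * _ + 20 = p + (5 + ((p + k + 12) + (1 + (1 + (1 + k))))))%N; last by lia.
move: (p + k + 12)%N KE => r KE.
rewrite natrX !exprD !expr1.
have dp j : 0 <= d%:R ^+ j :> R by exact: exprn_ge0.
have xp j : 0 <= x ^+ j by apply: exprn_ge0; exact: ltW.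
have D0 : 0 <= d%:R :> R by [].
have X0 := ltW x0; have KK0 := ltW K0.
have two5 : 0 <= 2 ^+ 5 :> R by exact: exprn_ge0.
apply: ler_pM; rewrite ?mulr_ge0//; first by apply: le_trans Cp _; exact: natr_le_pow2.
apply: ler_pM; rewrite ?mulr_ge0//; first exact: natr_le_pow2.
apply: ler_pM; rewrite ?mulr_ge0//; first by rewrite KE; exact: natr_le_pow2.
do 2 (apply: ler_pM; rewrite ?mulr_ge0//).
by apply: ler_pM => //; apply: lerXn2r => //; rewrite nnegrE.
Qed.

End Budgets.

Theorem theorem4p3 (R : realType) (Cm Cs : R) (km ks : nat) :
  exists (c C : R) (k : nat), 0 < c /\ 0 < C /\
  forall (n d m s : nat)
    (V : {vspace 'cV[R]_n}) (A : 'M[R]_(n, d))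
    (disp : measure_display) (T : measurableType disp) (P : probability T R)
    (u : 'I_n -> {RV P >-> R})
    (S : T -> 'M[R]_(\sum_(j < s) (m %/ s), n)),
  (1 < d)%N ->
  (0 < s)%N ->
  (s %| m)%N ->
  m%:R <= Cm * d%:R * ln (d%:R : R) ^+ km ->
  s%:R <= Cs * ln (d%:R : R) ^+ ks ->
  \dim V = d ->
  auerbach_basis V A ->
  iid_standard_exponential u ->
  sparse_sign_form P S ->
  oblivious_subspace_embedding P d S ->
  discrete_independent S u ->
  ((2 / 3 : R)%:E <=
    P [set w | forall x : 'cV[R]_d,
         (let Pi := S w *m inverse_diag u w in
         c * Num.max (d%:R * ln (d%:R : R))^-1
                     (Num.sqrt (d%:R * ln (d%:R : R) * ln (n%:R : R)))^-1
           * l1norm (A *m x)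
         <= l1norm (Pi *m A *m x)
         <= C * d%:R * ln (d%:R : R) ^+ k * l1norm (A *m x))%R])%E.
Proof.
have [p1 Cp1] := natr_pow2_bound Cm.
(* Chosen so that [m <= d^a], which gives [m tau <= 1] for the threshold [tau = d^-a]. *)
pose a := (p1 + km.+1)%N.
pose C : R := 1600 * (a + 8)%:R * `|Cs| + 35 * 2 ^+ ks.+1.
have C0 : 0 < C.
  apply: ltr_wpDl; first by rewrite mulr_ge0 ?mulr_ge0 ?ler0n.
  by rewrite mulr_gt0 ?exprn_gt0 ?ltr0n.
have [p Cp] := natr_pow2_bound C.
pose z := (p + ks.+1)%N.
have hK := linear_le_pow2 R z; set K : R := 2 ^+ (z + 12) in hK.
have K0 : 0 < K by rewrite exprn_gt0.
have [K2 K199] : 2 <= K /\ 199 <= K by have : 0 <= z%:R :> R by []; lra.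
(* Here [32 K = 4 K * 8]: [4 K] comes from [sqrt_inv_lower], [8] from [net_distortion]. The extra
   logarithm in [ks.+1] is the number of heavy layers. *)
exists (32 * K)^-1, C, ks.+1; split; first by rewrite invr_gt0 mulr_gt0.
split => // n d m s V A disp T P u S d1 s0 s_m hm hs dimV aA iidu formS oseS indepS.
have dn : (d <= n)%N.
  by rewrite -dimV; apply: leq_trans (dimvS (subvf V)) _; rewrite dimvf /dim/= muln1.
have n1 : (1 < n)%N by exact: leq_trans dn.
have d0 : 0 < d%:R :> R by rewrite ltr0n ltnW.
have x0 : 0 < ln (d%:R : R) by apply: lt_le_trans (ln_ge_half R d1); rewrite divr_gt0.
have y0 : 0 < ln (n%:R : R) by apply: lt_le_trans (ln_ge_half R n1); rewrite divr_gt0.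
have dx0 : 0 < d%:R * ln (d%:R : R) by rewrite mulr_gt0.
have [e [de e0 ex]] := dyadic_exponent R d1.
pose tau : R := (d%:R ^+ a)^-1.
have tau0 : 0 < tau by rewrite invr_gt0 exprn_gt0.
have tau1 : tau <= 1 by rewrite invf_le1 ?exprn_gt0// exprn_ege1// ler1n ltnW.
have mtau : m%:R * tau <= 1.
  by rewrite ler_pdivrMr ?exprn_gt0// mul1r; exact: dimension_le_pow hm.
pose J := (e * (a + 8))%N.
have J0 : 0 < J%:R :> R by rewrite ltr0n muln_gt0 e0 addn_gt0 orbT.
pose b1 : R := 400 * d%:R * J%:R.
pose b2 : R := 500 * d%:R * tau.
have c400 : 0 < 400 :> R by rewrite ltr0n.
have c500 : 0 < 500 :> R by rewrite ltr0n.
have b10 : 0 < b1 := mulr_gt0 (mulr_gt0 c400 d0) J0.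
have b20 : 0 < b2 := mulr_gt0 (mulr_gt0 c500 d0) tau0.
pose q := (d ^ (2 * z + 20))%N.
have q0 : (0 < q)%N by rewrite expn_gt0 (ltnW d1).
pose t := K * (d%:R * ln d%:R); pose l := K * ln n%:R.
have t0 : 0 < t by rewrite mulr_gt0.
have L1 : 1 <= Num.min t l.
  rewrite le_min; apply/andP; split; apply: one_le_mul_half => //; last exact: ln_ge_half.
  by apply: le_trans (one_le_mul_ln R d1); rewrite ler_pdivrMr// mul1r ler1n.
have [low1 low2] := sqrt_inv_lower K0 dx0 y0.
have hU : Num.sqrt s%:R * b1 + Num.sqrt m%:R * (3 / 2 * Num.sqrt (d%:R * b2)) <=
    C * d%:R * ln d%:R ^+ ks.+1 by exact: upper_constant.
have h2 := @mesh_budget R d p ks.+1 _ C K d1 (ltW C0) Cp erefl hU.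
have inv8 : 0 <= 8^-1 :> R by rewrite invr_ge0 ler0n.
have hG := @sketch_distortion R n d m s V A disp T P u S s_m dimV aA iidu formS oseS indepS
  J n q tau b1 b2 t l tau0 b10 b20 t0 L1 q0 (grid_mesh _ d1 (ltn_addl (2 * z) (isT : 1 < 20)%N))
  (le_trans h2 (ler_wpM2r inv8 low2)) (heavy_budget _ d1 e0 de (erefl J))
  (light_budget _ (ltnW d1) tau0 tau1) (maximum_budget n1 K199) (net_budget d1 hK).
have c1 : 0 <= (32 * K)^-1 * Num.max (d%:R * ln d%:R)^-1
    (Num.sqrt (d%:R * ln d%:R * ln (n%:R : R)))^-1.
  by rewrite mulr_ge0 ?invr_ge0 ?mulr_ge0 ?(ltW K0) ?le_max ?invr_ge0 ?(ltW dx0).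
have c2 : 0 <= C * d%:R * ln d%:R ^+ ks.+1.
  by rewrite mulr_ge0 ?mulr_ge0 ?exprn_ge0 ?(ltW C0) ?(ltW d0) ?(ltW x0).
have mfin := measurable_sketch_distortion A u formS c1 c2.
rewrite probE// lee_fin; apply: le_trans hG _.
apply: prob_le => //.
  apply: measurable_sketch_distortion => //.
  apply: addr_ge0; first exact: mulr_ge0 (sqrtr_ge0 _) (ltW b10).
  by rewrite mulr_ge0 ?sqrtr_ge0// mulr_ge0 ?sqrtr_ge0.
move=> w hw v /=; have /andP[lo up] := hw v; apply/andP; split.
  apply: le_trans lo; apply: ler_wpM2r; first exact: l1norm_ge0.
  apply: (@le_trans _ _ ((4 * K)^-1 *
      (Num.sqrt (d%:R * ln d%:R * Num.min (d%:R * ln d%:R) (ln n%:R)))^-1 / 8)).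
    rewrite (_ : (32 * K)^-1 = (4 * K)^-1 / 8); last by field; rewrite gt_eqF.
    rewrite mulrAC; apply: ler_wpM2r => //; apply: ler_wpM2l; first by rewrite invr_ge0 mulr_ge0 ?(ltW K0).
    exact: max_inv_le_inv_sqrt.
  by apply: ler_wpM2r.
by apply: le_trans up _; apply: ler_wpM2r => //; exact: l1norm_ge0.
Qed.
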